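(* There exist a symmetric function space $E\subset L_0(0,\infty)$ and a symmetric Banach norm $N$ on $E$ (that is, $(E,N)$ is a symmetric Banach lattice) such that, for all $u,v\in E$, $$u\prec\!\prec_{\log} v\quad\Longrightarrow\quad N(u)\le N(v),$$ but $N$ is not strongly symmetric. More precisely, there are nonnegative decreasing functions $f,g\in E$ such that $$g\prec\!\prec f\qquad\text{and}\qquad N(g)>N(f).$$ Moreover, $N$ is equivalent to the standard norm of a Marcinkiewicz space (that is, $E=M_\psi(0,\infty)$ as a set for some Marcinkiewicz space $M_\psi(0,\infty)$, and $N$ is equivalent to $\|\cdot\|_{M_\psi}$ on it), but $N$ does not have the Fatou property.
   Context: $L_0(0,\infty)$ is the vector lattice of all real- or complex-valued Lebesgue measurable functions on $(0,\infty)$ that are finite almost everywhere, modulo a.e. equality, with pointwise a.e. order. For $h\in L_0(0,\infty)$, $h^*$ denotes the decreasing rearrangement of $|h|$ (with respect to Lebesgue measure). ''Decreasing'' means non-increasing. Hardy--Littlewood submajorization: $u\prec\!\prec v$ means $\int_0^t u^*(s)\,ds\le\int_0^t v^*(s)\,ds$ for all $t>0$. Logarithmic submajorization: provided the positive parts of $\log u^*$ and $\log v^*$ are locally integrable (integrable over $(0,t)$ for each finite $t>0$), $u\prec\!\prec_{\log} v$ means $\int_0^t\log u^*(s)\,ds\le\int_0^t\log v^*(s)\,ds$ for all $t>0$, where $\log 0=-\infty$ and integrals are extended integrals in $[-\infty,\infty)$. A Banach lattice $E\subset L_0(0,\infty)$ with norm $\|\cdot\|_E$ is symmetric if, whenever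 $v\in E$, $u\in L_0(0,\infty)$ and $u^*\le v^*$, one has $u\in E$ and $\|u\|_E\le\|v\|_E$. (The Fatou property is not assumed.) It (or its norm) is strongly symmetric if $u,v\in E$ and $u\prec\!\prec v$ imply $\|u\|_E\le\|v\|_E$. The norm has the Fatou property if, whenever $0\le h_m\uparrow h$ a.e. with $h_m\in E$ and $\sup_m\|h_m\|_E<\infty$, one has $h\in E$ and $\|h_m\|_E\uparrow\|h\|_E$. Marcinkiewicz space: for an increasing concave function $\psi:(0,\infty)\to(0,\infty)$ with $\psi(0+)=0$, $M_\psi(0,\infty)=\{h\in L_0(0,\infty):\ \|h\|_{M_\psi}:=\sup_{t>0}\frac{1}{\psi(t)}\int_0^t h^*(s)\,ds<\infty\}$; $\|\cdot\|_{M_\psi}$ is its standard norm. *)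

(* Defs.v *)
From HB Require Import structures.
From mathcomp Require Import all_boot all_order all_algebra.
From mathcomp Require Import all_classical all_reals all_analysis.
From mathcomp.real_closed Require Import complex.

Set Implicit Arguments.
Unset Strict Implicit.
Unset Printing Implicit Defensive.

Import Order.TTheory GRing.Theory Num.Theory.
Import numFieldNormedType.Exports.

Local Open Scope classical_set_scope.
Local Open Scope ring_scope.

Variant scalar_kind := RealScalars | ComplexScalars.

Definition scalar_field (R : realType) (k : scalar_kind) : numFieldType :=
  match k with
  | RealScalars => R
  | ComplexScalars => R[i]
  end.

(* The R-valued absolute value: the norm of the numFieldType
   [scalar_field R k] is itself [scalar_field R k]-valued. *)
Definition modulus (R : realType) (k : scalar_kind) : scalar_field R k -> R :=
  match k return scalar_field R k -> R with
  | RealScalars => fun z : R => `|z|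
  | ComplexScalars => fun z : R[i] => ComplexField.Normc.normc z
  end.

Definition real_part (R : realType) (k : scalar_kind) :
    scalar_field R k -> scalar_field R k :=
  match k return scalar_field R k -> scalar_field R k with
  | RealScalars => fun z : R => z
  | ComplexScalars => fun z : R[i] => (complex.Re z)%:C%C
  end.

(* R with the Lebesgue (not just Borel) sigma-algebra, that is, the domain of
   [completed_lebesgue_measure]. *)
Notation lebesgueType R :=
  (caratheodory_type (@wlength R idfun)^*%mu).

(* Functions on (0, oo) are functions on R whose values outside (0, oo) are
   ignored; elements of L_0 are represented by everywhere finite functions and
   spaces of classes by sets of functions closed under a.e. equality. *)
Definition ae_halfline (R : realType) (P : R -> Prop) : Prop :=
  {ae @completed_lebesgue_measure R, forall x : R, 0 < x -> P x}.

Definition lebesgue_measurable (R : realType) (f : R -> R) : Prop :=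
  measurable_fun (`]0, +oo[ : set (lebesgueType R))
                 (f : lebesgueType R -> measurableTypeR R).

Definition L0 (R : realType) (k : scalar_kind) : set (R -> scalar_field R k) :=
  match k return set (R -> scalar_field R k) with
  | RealScalars => [set h : R -> R | lebesgue_measurable h]
  | ComplexScalars => [set h : R -> R[i] |
      lebesgue_measurable (fun x => complex.Re (h x)) /\
      lebesgue_measurable (fun x => complex.Im (h x))]
  end.

Definition distribution_function (R : realType) (k : scalar_kind)
    (h : R -> scalar_field R k)
    (s : R) : \bar R :=
  @completed_lebesgue_measure R [set x : R | 0 < x /\ s < modulus (h x)].

(* [\bar R]-valued: elements of L_0 may have an infinite rearrangement. *)
Definition rearrangement (R : realType) (k : scalar_kind)
    (h : R -> scalar_field R k) (t : R) : \bar R :=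
  ereal_inf [set s%:E | s in [set s : R | 0 <= s /\
                                (distribution_function h s <= t%:E)%E]].

Definition submajorized (R : realType) (k : scalar_kind)
    (u v : R -> scalar_field R k) : Prop :=
  forall t : R, 0 < t ->
    (\int[@lebesgue_measure R]_(s in `]0%R, t[) rearrangement u s <=
     \int[@lebesgue_measure R]_(s in `]0%R, t[) rearrangement v s)%E.

Definition log_admissible (R : realType) (k : scalar_kind)
    (u : R -> scalar_field R k) : Prop :=
  forall t : R, 0 < t ->
    (@lebesgue_measure R).-integrable `]0, t[
      (fun s => lne (rearrangement u s))^\+%E.

(* [lne 0 = -oo]; the integrals take values in [-oo, +oo) by
   [log_admissible]. *)
Definition log_submajorized (R : realType) (k : scalar_kind)
    (u v : R -> scalar_field R k) : Prop :=
  [/\ log_admissible u, log_admissible v &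
      forall t : R, 0 < t ->
        (\int[@lebesgue_measure R]_(s in `]0%R, t[) lne (rearrangement u s) <=
         \int[@lebesgue_measure R]_(s in `]0%R, t[) lne (rearrangement v s))%E].

(* For complex scalars, a sublattice is the complexification of a real one:
   it is stable under real parts and moduli. *)
Record vector_sublattice (R : realType) (k : scalar_kind)
    (E : set (R -> scalar_field R k)) : Prop := {
  vsl_L0 : E `<=` @L0 R k ;
  vsl_ae : forall u v, E u -> L0 v -> ae_halfline (fun x => u x = v x) -> E v ;
  vsl_zero : E (fun=> 0) ;
  vsl_add : forall u v, E u -> E v -> E (fun x => u x + v x) ;
  vsl_scale : forall (c : scalar_field R k) u, E u -> E (fun x => c * u x) ;
  vsl_real_part : forall u, E u -> E (fun x => real_part (u x)) ;
  vsl_modulus : forall u, E u -> E (fun x => `|u x|)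
}.

(* Only the values of [N] on [E] matter. *)
Record lattice_norm (R : realType) (k : scalar_kind)
    (E : set (R -> scalar_field R k))
    (N : (R -> scalar_field R k) -> R) : Prop := {
  ln_ge0 : forall u, E u -> 0 <= N u ;
  ln_eq0 : forall u, E u -> (N u = 0 <-> ae_halfline (fun x => u x = 0)) ;
  ln_scale : forall (c : scalar_field R k) u, E u ->
    N (fun x => c * u x) = modulus c * N u ;
  ln_triangle : forall u v, E u -> E v -> N (fun x => u x + v x) <= N u + N v ;
  ln_monotone : forall u v, E u -> E v ->
    ae_halfline (fun x => `|u x| <= `|v x|) -> N u <= N v
}.

Definition norm_complete (R : realType) (k : scalar_kind)
    (E : set (R -> scalar_field R k))
    (N : (R -> scalar_field R k) -> R) : Prop :=
  forall u : nat -> R -> scalar_field R k, (forall n, E (u n)) ->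
    (forall e : R, 0 < e -> exists n0 : nat, forall m n : nat,
       (n0 <= m)%N -> (n0 <= n)%N -> N (fun x => u m x - u n x) < e) ->
    exists2 l, E l & N (fun x => u n x - l x) @[n --> \oo] --> (0 : R).

Definition Banach_lattice (R : realType) (k : scalar_kind)
    (E : set (R -> scalar_field R k))
    (N : (R -> scalar_field R k) -> R) : Prop :=
  [/\ vector_sublattice E, lattice_norm E N & norm_complete E N].

Definition symmetric_Banach_lattice (R : realType) (k : scalar_kind)
    (E : set (R -> scalar_field R k))
    (N : (R -> scalar_field R k) -> R) : Prop :=
  Banach_lattice E N /\
  forall u v, E v -> L0 u ->
    (forall t : R, 0 < t -> (rearrangement u t <= rearrangement v t)%E) ->
    E u /\ N u <= N v.

Definition strongly_symmetric (R : realType) (k : scalar_kind)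
    (E : set (R -> scalar_field R k))
    (N : (R -> scalar_field R k) -> R) : Prop :=
  forall u v, E u -> E v -> submajorized u v -> N u <= N v.

Definition Fatou_property (R : realType) (k : scalar_kind)
    (E : set (R -> scalar_field R k))
    (N : (R -> scalar_field R k) -> R) : Prop :=
  forall (h : nat -> R -> scalar_field R k) (l : R -> scalar_field R k),
    (forall m, E (h m)) -> L0 l ->
    ae_halfline (fun x =>
      [/\ forall m, 0 <= h m x, forall m, h m x <= h m.+1 x &
          modulus (h m x - l x) @[m --> \oo] --> (0 : R)]) ->
    (exists M : R, forall m, N (h m) <= M) ->
    [/\ E l, nondecreasing_seq (fun m => N (h m)) &
        N (h m) @[m --> \oo] --> N l].

Record Marcinkiewicz_weight (R : realType) (psi : R -> R) : Prop := {
  mw_gt0 : forall t, 0 < t -> 0 < psi t ;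
  mw_increasing : forall s t, 0 < s -> s <= t -> psi s <= psi t ;
  mw_concave : forall a s t, 0 <= a <= 1 -> 0 < s -> 0 < t ->
    a * psi s + (1 - a) * psi t <= psi (a * s + (1 - a) * t) ;
  mw_zero : psi t @[t --> 0^'+] --> (0 : R)
}.

Definition Marcinkiewicz_norm (R : realType) (k : scalar_kind) (psi : R -> R)
    (h : R -> scalar_field R k) : \bar R :=
  ereal_sup [set ((psi t)^-1%:E *
      \int[@lebesgue_measure R]_(s in `]0%R, t[) rearrangement h s)%E
    | t in [set t : R | 0 < t]].

Definition Marcinkiewicz_space (R : realType) (k : scalar_kind)
    (psi : R -> R) : set (R -> scalar_field R k) :=
  [set h | L0 h /\ (Marcinkiewicz_norm psi h < +oo)%E].

Definition equivalent_to_Marcinkiewicz_norm (R : realType) (k : scalar_kind)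
    (E : set (R -> scalar_field R k))
    (N : (R -> scalar_field R k) -> R)
    (psi : R -> R) : Prop :=
  exists c C : R, [/\ 0 < c, 0 < C & forall u, E u ->
    (c%:E * Marcinkiewicz_norm psi u <= (N u)%:E <=
     C%:E * Marcinkiewicz_norm psi u)%E].

Definition nonneg_decreasing (R : realType) (k : scalar_kind)
    (f : R -> scalar_field R k) : Prop :=
  (forall x, 0 < x -> 0 <= f x) /\
  (forall x y, 0 < x -> x <= y -> f y <= f x).

(* Main.v *)
From HB Require Import structures.
Require Import Defs.
From mathcomp Require Import all_boot all_order all_algebra.
From mathcomp Require Import all_classical all_reals all_analysis.
From mathcomp Require Import measurable_realfun.
From mathcomp Require Import ring lra zify.
From mathcomp.real_closed Require Import complex.

Set Implicit Arguments.
Unset Strict Implicit.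
Unset Printing Implicit Defensive.

Import Order.TTheory GRing.Theory Num.Theory.
Import numFieldNormedType.Exports.
Local Open Scope classical_set_scope.
Local Open Scope ring_scope.

(** Write [X^*] for the decreasing rearrangement of [X], and for levels [c <= M] put
[G_c X = \int (|X| - c)^+] and [W_(c,M) X = \int (min(|X|, M) - c)^+].  Both are
cheap to handle: they are sublinear up to a change of levels, because
[(x + y - c - d)^+ <= (x - c)^+ + (y - d)^+], and they depend only on [X^*],
because [|X|] and [X^*] have the same distribution.

The reference function is the lacunary [f = \sum_n 2^n / t_n 1_(0, t_n)] with
[t_n = 2^(2 n^2 + n)], and [psi t = \int_0^t f].  Submajorization by [A f], that
is [\int_0^t X^* <= A psi t] for all [t], is the same as [G_(A c) X <= A G_c f]
for all [c > 0], by the K-functional formula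
[\int_0^t X^* = min_c (t c + G_c X)] ([integral_star_le], [integral_star_eq]).
This condition ([dominated A X]) defines the Marcinkiewicz norm of [M_psi].

The norm asks for more.  The heights [a_n = 1 / t_n] lie in the middle of the huge
gaps between consecutive values of [f], so that [f] carries almost nothing at
heights comparable to [a_n].  Call [X] [flat] with constant [A] when, for every
[k], [W_(a_n / k, k a_n) X <= (A / 4) 2^n] for all large [n]; the norm is the least
[A] for which [X] is both dominated and flat.  Letting [k] be arbitrary makes
flatness insensitive to fixed multiplicative changes of height, whence the triangle
inequality and homogeneity.  A dominated function satisfies [G_(a_n / k) X =
O(2^n)] for each fixed [k], hence is automatically flat with a comparable constant,
so the norm is equivalent to that of [M_psi]; completeness follows, by Fatou's
lemma, from domination alone.

Replacing each [t_n] by [s_n = 2^n / a_n] spreads the [n]-th piece of [f] down to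
the height [a_n] and gives a function [g] submajorized by [f].  But [f] is flat
with every positive constant, while [g] carries mass [2^n / 2] in the window
[[a_n / 2, 2 a_n]]; this forces [N g >= 2 > 1 >= N f].  The truncations of [g] to
bounded sets vanish in the windows asymptotically, so they have norm at most [1]
and increase to [g]: the Fatou property fails.

Logarithmic submajorization cannot move mass into a window.  It gives
[\int log^+ (u^* / r) <= \int log^+ (v^* / r)] for every [r > 0]
([log_excess_le_of_log_submajorized]).  A nonnegative combination of functions
[log^+ (x / r)] over a geometric grid of ratio [q] lies between [W_(c,M)] and
[q W_(c,M')] plus the error [(q M / M') (x - M')^+] ([log_comb_lower],
[log_comb_le]), so [W_(c,M) u <= q W_(c,M') v + (q M / M') G_M' v]
([band_le_of_log]).  In the windows, [M' = k' a_n] makes the error term a small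
multiple of [2^n] once [k'] is large, and [q] is as close to [1] as wanted. *)

(** * Layer cake *)

Section layer_cake.
Local Open Scope ereal_scope.

(** The layer-cake formula: Tonelli applied to the subgraph of [X]. *)
Lemma integral_tail d (T : measurableType d) (R : realType)
    (m : {sigma_finite_measure set T -> \bar R}) (X : T -> \bar R) :
  measurable_fun [set: T] X -> (forall x, 0 <= X x) ->
  \int[m]_x X x =
  \int[@lebesgue_measure R]_(s in `[0%R, +oo[) m [set x | s%:E < X x].
Proof.
move=> mX X0.
(* The subgraph of [X], whose sections are the intervals [[0, X x)] and the superlevel sets. *)
pose A : set (T * measurableTypeR R) := [set p | (0 <= p.2)%R /\ p.2%:E < X p.1].
have mA : measurable A.
  have -> : A = [set p : T * measurableTypeR R | (0 <= p.2)%R] `&`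
      [set p : T * measurableTypeR R | p.2%:E < X p.1] by [].
  apply: measurableI.
    rewrite [X in measurable X](_ : _ = snd @^-1` `[0%R, +oo[); last first.
      by apply/seteqP; split => p /=; rewrite in_itv/= andbT.
    rewrite -[X in measurable X]setTI.
    exact: (@measurable_snd _ _ T (measurableTypeR R) measurableT).
  rewrite -[X in measurable X]setTI; apply: measurable_lte => //.
    by apply: measurableT_comp => //; exact/measurable_EFinP/measurable_snd.
  exact: measurableT_comp.
pose B x : set R := [set s | (0 <= s)%R /\ s%:E < X x].
have secX x : \int[@lebesgue_measure R]_s (\1_A (x, s))%:E = X x.
  rewrite [LHS](_ : _ = \int[@lebesgue_measure R]_s (\1_(B x) s)%:E); last first.
    by apply: eq_integral => s _; rewrite !indicE.
  have [xf|] := boolP (X x \is a fin_num).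
    have -> : B x = `[0%R, fine (X x)[%classic.
      apply/seteqP; split => s /=; rewrite in_itv/=.
        by move=> [s0 sx]; apply/andP; split=> //; rewrite -lte_fin fineK.
      by move=> /andP[s0 sx]; split => //; rewrite -(fineK xf) lte_fin.
    rewrite integral_indic//= setIT lebesgue_measure_itv/= lte_fin.
    case: ltP => h; first by rewrite oppr0 adde0 fineK.
    by apply/eqP; rewrite eq_le X0 /= -(fineK xf) lee_fin.
  rewrite fin_numE negb_and !negbK => /orP[/eqP xE|/eqP xE].
    by have := X0 x; rewrite xE leeNy_eq.
  have -> : B x = `[0%R, +oo[%classic.
    apply/seteqP; split => s /=; rewrite in_itv/= ?andbT; first by case.
    by move=> s0; split => //; rewrite xE ltry.
  by rewrite integral_indic//= setIT lebesgue_measure_itv/= ltry xE.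
transitivity (\int[m]_x \int[@lebesgue_measure R]_s (\1_A (x, s))%:E).
  by apply: eq_integral => x _; rewrite secX.
rewrite (fubini_tonelli (m1 := m) (m2 := @lebesgue_measure R)
  (fun p : T * measurableTypeR R => (\1_A p)%:E))//=; last first.
  by apply/measurable_EFinP/measurable_indic.
rewrite [RHS]integral_mkcond; apply: eq_integral => s _.
rewrite patchE; case: ifPn => [|].
  rewrite inE/= in_itv/= andbT => s0.
  pose C : set T := [set x | s%:E < X x].
  rewrite (eq_integral (fun x => (\1_C x)%:E)); last first.
    move=> x _; rewrite !indicE; congr (_%:R%:E); congr nat_of_bool.
    by apply/idP/idP; rewrite !inE /A/=; first case.
  rewrite integral_indic//= ?setIT//.
  by rewrite -[X in measurable X]setTI; exact: emeasurable_fun_o_infty.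
move=> /negP s0; apply: integral0_eq => x _; rewrite indicE memNset//.
by move=> [/= ss _]; apply: s0; rewrite inE/= in_itv/= ss.
Qed.

(** The measure spaces may differ: this is what transfers integrals between a
function and its rearrangement. *)
Lemma eq_integral_tail d1 d2 (T1 : measurableType d1) (T2 : measurableType d2)
    (R : realType) (m1 : {sigma_finite_measure set T1 -> \bar R})
    (m2 : {sigma_finite_measure set T2 -> \bar R}) (D1 : set T1) (D2 : set T2)
    (X : T1 -> \bar R) (Y : T2 -> \bar R) :
  measurable D1 -> measurable D2 ->
  measurable_fun D1 X -> measurable_fun D2 Y ->
  (forall x, D1 x -> 0 <= X x) -> (forall y, D2 y -> 0 <= Y y) ->
  (forall s : R, (0 <= s)%R ->
    m1 [set x | D1 x /\ s%:E < X x] = m2 [set y | D2 y /\ s%:E < Y y]) ->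
  \int[m1]_(x in D1) X x = \int[m2]_(y in D2) Y y.
Proof.
move=> mD1 mD2 mX mY X0 Y0 XY.
have tailE d (T : measurableType d) (m : {sigma_finite_measure set T -> \bar R})
    (D : set T) (Z : T -> \bar R) : measurable D -> measurable_fun D Z ->
    (forall x, D x -> 0 <= Z x) ->
    \int[m]_(x in D) Z x =
    \int[@lebesgue_measure R]_(s in `[0%R, +oo[) m [set x | D x /\ s%:E < Z x].
  move=> mD mZ Z0; rewrite integral_mkcond integral_tail; last 2 first.
    by apply/(measurable_restrictT _ _).1.
    exact: erestrict_ge0.
  apply: eq_integral => s; rewrite inE/= in_itv/= andbT => s0; congr (m _).
  apply/seteqP; split => x /=; rewrite patchE.
    by case: ifPn => [/set_mem//|_]; rewrite lte_fin ltNge s0.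
  by move=> [Dx sx]; rewrite mem_set.
rewrite (tailE _ _ m1)// (tailE _ _ m2)//; apply: eq_integral => s; rewrite inE/= in_itv/= andbT.
exact: XY.
Qed.

End layer_cake.

(** * Decreasing rearrangements *)

Definition level_measure (R : realType) (X : R -> R) (s : R) : \bar R :=
  @completed_lebesgue_measure R [set x : R | 0 < x /\ s < X x].

(** The decreasing rearrangement of a nonnegative real function; for a scalar function
[h] it is applied to [modulus \o h]. *)
Definition star (R : realType) (X : R -> R) (t : R) : \bar R :=
  ereal_inf [set s%:E | s in [set s : R | 0 <= s /\ (level_measure X s <= t%:E)%E]].

Definition integral_of (R : realType) (phi X : R -> R) : \bar R :=
  (\int[@completed_lebesgue_measure R]_(x in `]0%R, +oo[) (phi (X x))%:E)%E.

Section rearrangement_theory.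
Context {R : realType}.
Implicit Types (X Y phi : R -> R) (s t r c M : R).
Local Notation mu := (@completed_lebesgue_measure R).
Local Notation leb := (@lebesgue_measure R).

Lemma rearrangementE k (h : R -> scalar_field R k) :
  rearrangement h = star (fun x => modulus (h x)).
Proof. by []. Qed.

Lemma measurable_halfline : measurable (`]0, +oo[%classic : set (lebesgueType R)).
Proof. by apply: sub_caratheodory; exact: measurable_itv. Qed.

Lemma measurable_level X s : lebesgue_measurable X ->
  measurable ([set x : R | 0 < x /\ s < X x] : set (lebesgueType R)).
Proof.
move=> mX; have := mX measurable_halfline _ (measurable_itv `]s, +oo[).
congr measurable; apply/seteqP; split => x /=; rewrite !in_itv/= !andbT.
  by case.
by case.
Qed.

Lemma level_measure_nonincreasing X s r : s <= r ->
  (level_measure X r <= level_measure X s)%E.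
Proof.
move=> sr; apply: le_outer_measure => x [x0 rx]; split => //.
exact: le_lt_trans rx.
Qed.

Lemma le_level_measure X Y s : ae_halfline (fun x => X x <= Y x) ->
  (level_measure X s <= level_measure Y s)%E.
Proof.
move=> [N [mN N0 XYN]].
apply: (@le_trans _ _ (mu ([set x : R | 0 < x /\ s < Y x] `|` N))).
  apply: le_outer_measure => x [x0 sX].
  have [XY|XY] := pselect (X x <= Y x); first by left; split => //; exact: lt_le_trans XY.
  by right; apply: XYN => /(_ x0).
apply: (le_trans (outer_measureU2 _ _ _)).
by rewrite [X in (_ + X)%E](_ : _ = 0%E)// adde0.
Qed.

Lemma star_ge0 X t : (0 <= star X t)%E.
Proof. by apply: le_ereal_inf_tmp => _ [s [s0 _] <-]; rewrite lee_fin. Qed.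

Lemma star_le X t s : 0 <= s -> (level_measure X s <= t%:E)%E -> (star X t <= s%:E)%E.
Proof. by move=> s0 ds; apply: ereal_inf_lbound; exists s. Qed.

(** Right continuity of the distribution function makes the two generalized inverses
of each other, so [star X] has the distribution of [X]. *)
Lemma lt_star X t s : lebesgue_measurable X -> 0 <= s ->
  (s%:E < star X t)%E <-> (t%:E < level_measure X s)%E.
Proof.
move=> mX s0; split => [|ts].
  by rewrite !ltNge; apply: contra => /(star_le s0).
pose F n : set (lebesgueType R) := [set x : R | 0 < x /\ s + n.+1%:R^-1 < X x].
have FE : \bigcup_n F n = [set x : R | 0 < x /\ s < X x].
  apply/seteqP; split => x /=.
    move=> [n _ [x0 sX]]; split => //; apply: lt_trans sX.
    by rewrite ltrDl invr_gt0.
  move=> [x0 sX]; have : 0 < X x - s by rewrite subr_gt0.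
  move=> /ltr_add_invr[n]; rewrite add0r => nX.
  by exists n => //; split => //; rewrite addrC -ltrBrDr.
have : (mu \o F) x @[x --> \oo] --> mu (\bigcup_n F n).
  apply: nondecreasing_cvg_mu => [n||n m nm].
  - exact: measurable_level.
  - by rewrite FE; exact: measurable_level.
  - apply/subsetPset => x [x0 sX]; split => //; apply: le_lt_trans sX.
    by rewrite lerD2l lef_pV2 ?posrE// ler_nat.
rewrite FE => /(_ _ (open_ereal_gt' ts))[n _ /(_ n (leqnn n))/= tn].
apply: (@lt_le_trans _ _ (s + n.+1%:R^-1)%:E).
  by rewrite lte_fin ltrDl invr_gt0.
apply: le_ereal_inf_tmp => _ [r [r0 dr] <-]; rewrite lee_fin leNgt; apply/negP => rs.
suff : (t%:E < t%:E)%E by rewrite ltxx.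
by apply: lt_le_trans tn (le_trans _ dr); exact/level_measure_nonincreasing/ltW.
Qed.

Lemma star_nonincreasing X s t : s <= t -> (star X t <= star X s)%E.
Proof.
move=> st; apply: ereal_inf_le_tmp => _ [r [r0 dr] <-]; exists r => //; split => //.
by apply: le_trans dr _; rewrite lee_fin.
Qed.

Lemma le_star X Y t : ae_halfline (fun x => X x <= Y x) -> (star X t <= star Y t)%E.
Proof.
move=> XY; apply: ereal_inf_le_tmp => _ [r [r0 dr] <-]; exists r => //; split => //.
exact: le_trans (le_level_measure _ XY) dr.
Qed.

Lemma nonincreasing_emeasurable (f : R -> \bar R) (b : itv_bound R) :
  (forall s t, 0 < s -> s <= t -> (f t <= f s)%E) ->
  measurable_fun ([set` Interval (BRight 0) b] : set (measurableTypeR R)) f.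
Proof.
move=> fD; apply: (measurability (@ErealGenOInfty.G R)).
  exact: ErealGenOInfty.measurableE.
move=> /= _ [_ [r ->] <-]; apply: is_interval_measurable => x y /=.
rewrite !in_itv/= !andbT => -[/andP[x0 xb] rx] [/andP[y0 yb] ry] z /andP[xz zy].
have z0 : 0 < z := lt_le_trans x0 xz.
split; rewrite /= in_itv/=.
  apply/andP; split => //.
  by case: b yb {xb} => [[]b|[]]//= yb; [exact: le_lt_trans yb|exact: le_trans yb].
by rewrite andbT; apply: lt_le_trans ry _; apply: fD => //; exact: lt_le_trans xz.
Qed.

Lemma measurable_star X (b : itv_bound R) :
  measurable_fun ([set` Interval (BRight 0) b] : set (measurableTypeR R)) (star X).
Proof. by apply: nonincreasing_emeasurable => s t _ st; exact: star_nonincreasing. Qed.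

(** Elements of L_0 may have an infinite rearrangement; those of a Marcinkiewicz space
do not, and then real integrands suffice. *)
Definition finite_star X := forall t, 0 < t -> (star X t < +oo)%E.

Lemma fine_starK X t : finite_star X -> 0 < t -> (fine (star X t))%:E = star X t.
Proof. by move=> fX t0; rewrite fineK// ge0_fin_numE ?star_ge0// fX. Qed.

Lemma measurable_fine_star X (b : itv_bound R) : finite_star X ->
  measurable_fun ([set` Interval (BRight 0) b] : set (measurableTypeR R))
    (fun t => fine (star X t)).
Proof.
move=> fX; apply: (measurable_comp (F := setT)) => //; last exact: measurable_star.
Qed.

(** The integrands [phi] for which [\int phi(X)] is a rearrangement invariant: their
superlevel sets at nonnegative levels are open half lines or empty, so the tails of [phi \o X] are tails of [X]. *)
Record height_function phi : Prop := {
  hf_measurable : measurable_fun [set: R] phi ;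
  hf_ge0 : forall x, 0 <= x -> 0 <= phi x ;
  hf_level : forall s, 0 <= s ->
    (exists2 r, 0 <= r & forall x, 0 <= x -> (s < phi x) = (r < x)) \/
    (forall x, 0 <= x -> phi x <= s)
}.

Lemma height_homo phi x y : height_function phi -> 0 <= x -> x <= y ->
  phi x <= phi y.
Proof.
move=> hphi x0 xy; have y0 := le_trans x0 xy; rewrite leNgt; apply/negP => yx.
have [[r r0 rP]|/(_ x x0)] := hf_level hphi (hf_ge0 hphi y0); last by rewrite leNgt yx.
have := yx; rewrite rP// => rx.
by have := lt_le_trans rx xy; rewrite -rP// ltxx.
Qed.

(** [X] and its rearrangement are equimeasurable. *)
Lemma integral_of_star phi X : height_function phi -> lebesgue_measurable X ->
  (forall x, 0 < x -> 0 <= X x) -> finite_star X ->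
  (\int[leb]_(t in `]0%R, +oo[) (phi (fine (star X t)))%:E = integral_of phi X)%E.
Proof.
move=> hphi mX X0 fX; apply: eq_integral_tail.
- exact: measurable_itv.
- exact: measurable_halfline.
- apply/measurable_EFinP; apply: measurableT_comp; first exact: hf_measurable.
  exact: measurable_fine_star.
- apply/measurable_EFinP; apply: measurableT_comp; first exact: hf_measurable.
  exact: mX.
- by move=> t _; rewrite lee_fin (hf_ge0 hphi)// fine_ge0// star_ge0.
- move=> x /=; rewrite in_itv/= andbT => x0.
  by rewrite lee_fin (hf_ge0 hphi)// X0.
move=> s s0; have [[r r0 rP]|sP] := hf_level hphi s0; last first.
  transitivity (0 : \bar R)%E.
    rewrite -[RHS](measure0 leb); congr (leb _).
    apply/seteqP; split => // t [_]; rewrite lte_fin ltNge sP//.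
    by rewrite fine_ge0// star_ge0.
  rewrite -[LHS](measure0 mu); congr (mu _).
  apply/seteqP; split => // x /= []; rewrite in_itv/= andbT lte_fin => x0.
  by move=> /lt_le_trans/(_ (sP _ (X0 _ x0))); rewrite ltxx.
transitivity (leb [set t | 0 < t /\ (t%:E < level_measure X r)%E]).
  congr (leb _); apply/seteqP; split => t /=; rewrite in_itv/= andbT.
    move=> [t0]; rewrite lte_fin rP ?fine_ge0 ?star_ge0// -lte_fin fine_starK//.
    by move=> /(lt_star t mX r0).
  move=> [t0 /(lt_star t mX r0) rt]; split => //.
  by rewrite lte_fin rP ?fine_ge0 ?star_ge0// -lte_fin fine_starK.
transitivity (level_measure X r); last first.
  congr (mu _); apply/seteqP; split => x /=; rewrite in_itv/= andbT lte_fin => -[x0].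
    by move=> rX; split => //; rewrite rP// X0.
  by rewrite rP// X0.
have : (0 <= level_measure X r)%E by exact: measure_ge0.
case: (level_measure X r) => [d d0| _ |//].
  rewrite [X in leb X](_ : _ = `]0%R, d[%classic); last first.
    by apply/seteqP; split => t /=; rewrite in_itv/= lte_fin => /andP.
  rewrite lebesgue_measure_itv/= lte_fin; case: ltP => [_|dl]; first by rewrite oppr0 adde0.
  by apply/esym/eqP; rewrite eq_le d0 lee_fin dl.
rewrite [X in leb X](_ : _ = `]0%R, +oo[%classic); last first.
  by apply/seteqP; split => t /=; rewrite in_itv/= ltry andbT; [case|].
by rewrite lebesgue_measure_itv/= ltry.
Qed.

End rearrangement_theory.

(** * Truncations and logarithms *)

(** [\int excess c X] is the functional [G_c] of the opening comment; [band] gives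
[W_(c,M)]. *)
Definition excess (R : realType) (c x : R) : R := Num.max (x - c) 0.
Definition band (R : realType) (c M x : R) : R := Num.max (Num.min x M - c) 0.
Definition log_excess (R : realType) (r x : R) : R := Num.max (ln (x / r)) 0.

Section heights.
Context {R : realType}.
Implicit Types (c M r x q : R).

Lemma excess_ge0 c x : 0 <= excess c x. Proof. by rewrite le_max lexx orbT. Qed.
Lemma band_ge0 c M x : 0 <= band c M x. Proof. by rewrite le_max lexx orbT. Qed.
Lemma log_excess_ge0 r x : 0 <= log_excess r x. Proof. by rewrite le_max lexx orbT. Qed.

Lemma excess_out c x : x <= c -> excess c x = 0.
Proof. by move=> xc; rewrite /excess max_r// subr_le0. Qed.
Lemma excess_in c x : c <= x -> excess c x = x - c.
Proof. by move=> xc; rewrite /excess max_l// subr_ge0. Qed.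

Lemma band_low c M x : x <= c -> band c M x = 0.
Proof. by move=> xc; rewrite /band max_r// subr_le0 ge_min xc. Qed.
Lemma band_mid c M x : c <= x -> x <= M -> band c M x = x - c.
Proof. by move=> cx xM; rewrite /band min_l// max_l// subr_ge0. Qed.
Lemma band_high c M x : c <= M -> M <= x -> band c M x = M - c.
Proof. by move=> cx xM; rewrite /band min_r// max_l// subr_ge0. Qed.

Lemma log_excess_out r x : 0 < r -> 0 <= x -> x <= r -> log_excess r x = 0.
Proof.
move=> r0 x0 xr; rewrite /log_excess max_r// ln_le0//.
by rewrite ler_pdivrMr// mul1r.
Qed.
Lemma log_excess_in r x : 0 < r -> r <= x -> log_excess r x = ln x - ln r.
Proof.
move=> r0 rx; have x0 := lt_le_trans r0 rx.
rewrite /log_excess max_l; first by rewrite ln_div ?posrE.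
by rewrite ln_ge0// ler_pdivlMr// mul1r.
Qed.

Lemma height_excess c : 0 <= c -> height_function (excess c).
Proof.
move=> c0; split => [|x _|s s0].
- by apply: measurable_maxr => //; apply: measurable_funD.
- exact: excess_ge0.
- left; exists (s + c); first exact: addr_ge0.
  by move=> x x0; rewrite /excess lt_max [s < 0]ltNge s0 orbF ltrBrDr.
Qed.

Lemma height_band c M : 0 <= c -> height_function (band c M).
Proof.
move=> c0; split => [|x _|s s0].
- by apply: measurable_maxr => //; apply: measurable_funD => //; apply: measurable_minr.
- exact: band_ge0.
- have [sM|sM] := ltP (s + c) M.
    left; exists (s + c); first exact: addr_ge0.
    by move=> x x0; rewrite /band lt_max [s < 0]ltNge s0 orbF ltrBrDr lt_min sM andbT.
  by right => x _; rewrite /band ge_max s0 andbT lerBlDr ge_min sM orbT.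
Qed.

Lemma height_log_excess r : 0 < r -> height_function (log_excess r).
Proof.
move=> r0; split => [|x _|s s0].
- apply: measurable_maxr => //; apply: measurableT_comp => //.
  exact: mulrr_measurable.
- exact: log_excess_ge0.
- left; exists (r * expR s); first by rewrite mulr_ge0 ?expR_ge0// ltW.
  move=> x; rewrite /log_excess lt_max [s < 0]ltNge s0 orbF le_eqVlt => /orP[/eqP<-|x0].
    by rewrite mul0r ln0// ltNge s0 /= ltNge mulr_ge0// ?expR_ge0// ltW.
  rewrite -{1}[s]expRK ltr_ln ?posrE ?expR_gt0// ?divr_gt0//.
  by rewrite ltr_pdivlMr// mulrC.
Qed.

Lemma bandD c M N x : c <= M -> M <= N -> band c N x = band c M x + band M N x.
Proof.
move=> cM MN; have cN := le_trans cM MN.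
have [xc|cx] := leP x c.
  by rewrite !band_low ?addr0// (le_trans xc).
have [xM|Mx] := leP x M.
  by rewrite (@band_low M N)// addr0 !band_mid ?(ltW cx)// (le_trans xM MN).
have [xN|Nx] := leP x N.
  by rewrite (band_mid (ltW cx) xN) (band_mid (ltW Mx) xN) (band_high cM (ltW Mx)); lra.
by rewrite (band_high cN (ltW Nx)) (band_high MN (ltW Nx)) (band_high cM (ltW Mx)); lra.
Qed.

Lemma excessD c M x : c <= M -> excess c x = band c M x + excess M x.
Proof.
move=> cM; have [xc|cx] := leP x c.
  by rewrite band_low// !excess_out ?addr0// (le_trans xc).
have [xM|Mx] := leP x M.
  by rewrite (@excess_out M)// addr0 band_mid ?excess_in// ltW.
rewrite (excess_in (ltW cx)) (excess_in (ltW Mx)) (band_high cM (ltW Mx)); lra.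
Qed.

Lemma le_band c c' M M' x : c' <= c -> M <= M' -> band c M x <= band c' M' x.
Proof.
move=> cc MM; rewrite /band ge_max !le_max lexx orbT andbT.
by rewrite lerB// le_min !ge_min lexx MM orbT.
Qed.

Lemma band_le_excess c M x : band c M x <= excess c x.
Proof. by rewrite /band /excess ge_max !le_max lexx orbT andbT lerB// ge_min lexx. Qed.

Lemma ln_le_sub1 (y : R) : 0 < y -> ln y <= y - 1.
Proof. move=> y0; rewrite [in ln _](_ : y = 1 + (y - 1)); last by ring.
by apply: le_ln1Dx; lra. Qed.

Lemma ler_mul_lnB r x : 0 < r -> 0 < x -> r * (ln x - ln r) <= x - r.
Proof.
move=> r0 x0; rewrite -ln_div ?posrE//.
have := ln_le_sub1 (divr_gt0 x0 r0); rewrite -(ler_pM2l r0); congr (_ <= _).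
by field; rewrite gt_eqF.
Qed.

(** Inside the window [x - r <= x (ln x - ln r)], from [ln y >= 1 - 1 / y], and [x <= s]. *)
Lemma band_le_log r s x : 0 < r -> r <= s -> 0 <= x ->
  band r s x + s * log_excess s x <= s * log_excess r x.
Proof.
move=> r0 rs x0; have s0 := lt_le_trans r0 rs.
have [xr|rx] := leP x r.
  by rewrite band_low// !log_excess_out ?mulr0 ?addr0// (le_trans xr).
have xp := lt_trans r0 rx.
have [xs|sx] := leP x s.
  rewrite band_mid ?(ltW rx)// (log_excess_out s0)// (log_excess_in r0 (ltW rx)).
  have h : 0 <= ln x - ln r by rewrite subr_ge0 ler_ln ?posrE// ltW.
  have := ler_mul_lnB xp r0; have := ler_wpM2r h xs; lra.
rewrite band_high ?(ltW sx)// (log_excess_in s0 (ltW sx)) (log_excess_in r0 (ltW rx)).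
have := ler_mul_lnB s0 r0; lra.
Qed.

(** The reverse comparison, with the lower end of the window as factor; it comes from
[ln y <= y - 1]. *)
Lemma log_le_band r s x : 0 < r -> r <= s -> 0 <= x ->
  r * log_excess r x <= band r s x + r * log_excess s x.
Proof.
move=> r0 rs x0; have s0 := lt_le_trans r0 rs.
have [xr|rx] := leP x r.
  by rewrite band_low// !log_excess_out ?mulr0 ?addr0// (le_trans xr).
have xp := lt_trans r0 rx.
have [xs|sx] := leP x s.
  rewrite band_mid ?(ltW rx)// (log_excess_out s0)// (log_excess_in r0 (ltW rx)).
  have := ler_mul_lnB r0 xp; lra.
rewrite band_high ?(ltW sx)// (log_excess_in s0 (ltW sx)) (log_excess_in r0 (ltW rx)).
have := ler_mul_lnB r0 s0; lra.
Qed.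

Lemma log_le_excess r x : 0 < r -> 0 <= x -> r * log_excess r x <= excess r x.
Proof.
move=> r0 x0; have [xr|rx] := leP x r.
  by rewrite log_excess_out// excess_out// mulr0.
rewrite (log_excess_in r0 (ltW rx)) (excess_in (ltW rx)).
by apply: ler_mul_lnB => //; exact: lt_trans rx.
Qed.

(** With [r_j = c q^j] and [l_j = log^+ (x / r_j)], this is the sum of the
[r_(j+1) (l_j - l_(j+1))], an upper Riemann sum for the window [[c, c q^m]], plus
[r_m l_m], after Abel summation: all weights of the [l_j] are nonnegative, so an
inequality between the integrals of the [l_j] carries over. *)
Fixpoint log_comb c q m x : R :=
  if m is m'.+1
  then log_comb c q m' x + (c * q ^+ m'.+1 - c * q ^+ m') * log_excess (c * q ^+ m') x
  else c * log_excess c x.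

Lemma log_comb_lower c q m x : 0 < c -> 1 < q -> 0 <= x ->
  band c (c * q ^+ m) x + c * q ^+ m * log_excess (c * q ^+ m) x <= log_comb c q m x.
Proof.
move=> c0 q1 x0; have q0 : 0 < q by lra.
elim: m => [|m IH]; first by rewrite expr0 mulr1 /band max_r ?add0r// subr_le0 ge_min lexx orbT.
rewrite /=; set r := c * q ^+ m in IH *; set s := c * q ^+ m.+1.
have r0 : 0 < r by rewrite mulr_gt0 ?exprn_gt0.
have rs : r <= s by rewrite ler_pM2l// exprS ler_peMl ?(ltW q1)// exprn_ge0 ?ltW.
have cr : c <= r by rewrite ler_peMr ?(ltW c0)// exprn_ege1 ?(ltW q1).
rewrite (bandD _ cr rs); have := band_le_log r0 rs x0; lra.
Qed.

Lemma log_comb_upper c q m x : 0 < c -> 1 < q -> 0 <= x ->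
  log_comb c q m x <=
  q * band c (c * q ^+ m) x + c * q ^+ m * log_excess (c * q ^+ m) x.
Proof.
move=> c0 q1 x0; have q0 : 0 < q by lra.
elim: m => [|m IH].
  by rewrite expr0 mulr1 /=; have := mulr_ge0 (ltW q0) (band_ge0 c c x); lra.
rewrite /=; set r := c * q ^+ m in IH *; set s := c * q ^+ m.+1.
have r0 : 0 < r by rewrite mulr_gt0 ?exprn_gt0.
have rs : r <= s by rewrite ler_pM2l// exprS ler_peMl ?(ltW q1)// exprn_ge0 ?ltW.
have cr : c <= r by rewrite ler_peMr ?(ltW c0)// exprn_ege1 ?(ltW q1).
have sE : s = q * r by rewrite /s /r exprS; ring.
rewrite (bandD _ cr rs); have := log_le_band r0 rs x0.
rewrite -(ler_pM2l q0) mulrDr !(mulrA q r) -sE; lra.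
Qed.

(** Above the grid the remaining term [r log^+ (x / r)] is cut at a higher level [N]; what
lies beyond [N] is damped by the factor [r / N]. *)
Lemma log_comb_le c q m N x : 0 < c -> 1 < q -> 0 <= x -> c * q ^+ m <= N ->
  log_comb c q m x <= q * band c N x + (c * q ^+ m / N) * excess N x.
Proof.
move=> c0 q1 x0; set r := c * q ^+ m => rN.
have q0 : 0 < q by lra.
have r0 : 0 < r by rewrite mulr_gt0 ?exprn_gt0.
have N0 := lt_le_trans r0 rN.
have cr : c <= r by rewrite ler_peMr ?(ltW c0)// exprn_ege1 ?(ltW q1).
have := log_comb_upper m c0 q1 x0; rewrite -/r (bandD _ cr rN).
have := log_le_band r0 rN x0.
have : r * log_excess N x <= r / N * excess N x.
  have := log_le_excess N0 x0.
  rewrite -(ler_pM2l (divr_gt0 r0 N0)); congr (_ <= _).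
  by rewrite mulrA divfK// gt_eqF.
have := ler_wpM2r (band_ge0 r N x) (ltW q1); lra.
Qed.

End heights.

(** * Integrals of truncations *)

Section integrals.
Context {R : realType}.
Implicit Types (X Y phi psi : R -> R) (s t r c M A : R).
Local Notation mu := (@completed_lebesgue_measure R).
Local Notation leb := (@lebesgue_measure R).

Definition nonneg_on_halfline X := forall x, 0 < x -> 0 <= X x.

Lemma measurable_comp_halfline phi X : measurable_fun [set: R] phi ->
  lebesgue_measurable X ->
  measurable_fun (`]0, +oo[%classic : set (lebesgueType R)) (fun x => (phi (X x))%:E).
Proof.
move=> mphi mX; apply/measurable_EFinP; apply: measurableT_comp; first exact: mphi.
exact: mX.
Qed.

Lemma integral_of_ge0 phi X : (forall x, 0 <= x -> 0 <= phi x) ->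
  nonneg_on_halfline X -> (0 <= integral_of phi X)%E.
Proof.
move=> phi0 X0; apply: integral_ge0 => x /=; rewrite in_itv/= andbT => x0.
by rewrite lee_fin phi0// X0.
Qed.

Lemma le_integral_of phi psi X Y :
  measurable_fun [set: R] phi -> measurable_fun [set: R] psi ->
  lebesgue_measurable X -> lebesgue_measurable Y ->
  (forall x, 0 < x -> 0 <= phi (X x) <= psi (Y x)) ->
  (integral_of phi X <= integral_of psi Y)%E.
Proof.
move=> mphi mpsi mX mY h; apply: ge0_le_integral.
- exact: measurable_halfline.
- move=> x /=; rewrite in_itv/= andbT => x0.
  by have /andP[? _] := h _ x0; rewrite lee_fin.
- exact: measurable_comp_halfline.
- exact: measurable_comp_halfline.
- move=> x /=; rewrite in_itv/= andbT => x0.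
  by have /andP[_ ?] := h _ x0; rewrite lee_fin.
Qed.

Lemma integral_ofD phi psi X a b :
  measurable_fun [set: R] phi -> measurable_fun [set: R] psi ->
  (forall x, 0 <= x -> 0 <= phi x) -> (forall x, 0 <= x -> 0 <= psi x) ->
  0 <= a -> 0 <= b -> lebesgue_measurable X -> nonneg_on_halfline X ->
  (integral_of (fun x => a * phi x + b * psi x)%R X =
   a%:E * integral_of phi X + b%:E * integral_of psi X)%E.
Proof.
move=> mphi mpsi phi0 psi0 a0 b0 mX X0; rewrite /integral_of.
have m1 := measurable_comp_halfline mphi mX.
have m2 := measurable_comp_halfline mpsi mX.
have p1 x : (`]0, +oo[%classic : set (lebesgueType R)) x -> (0 <= (phi (X x))%:E)%E.
  by rewrite /= in_itv/= andbT => x0; rewrite lee_fin phi0// X0.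
have p2 x : (`]0, +oo[%classic : set (lebesgueType R)) x -> (0 <= (psi (X x))%:E)%E.
  by rewrite /= in_itv/= andbT => x0; rewrite lee_fin psi0// X0.
have mD := @measurable_halfline R.
have q1 x : (`]0, +oo[%classic : set (lebesgueType R)) x -> (0 <= a%:E * (phi (X x))%:E)%E.
  by move=> Dx; rewrite mule_ge0// ?p1// lee_fin.
have q2 x : (`]0, +oo[%classic : set (lebesgueType R)) x -> (0 <= b%:E * (psi (X x))%:E)%E.
  by move=> Dx; rewrite mule_ge0// ?p2// lee_fin.
have n1 := measurable_funeM a%:E m1; have n2 := measurable_funeM b%:E m2.
have a0' : (0 <= a%:E)%E by rewrite lee_fin.
have b0' : (0 <= b%:E)%E by rewrite lee_fin.
rewrite -(ge0_integralZl mu mD m1 p1 a0') -(ge0_integralZl mu mD m2 p2 b0').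
exact: (ge0_integralD mu mD q1 n1 q2 n2).
Qed.

(** Monotone convergence in the upper truncation level. *)
Lemma integral_excess_le X c B : 0 <= c -> lebesgue_measurable X ->
  nonneg_on_halfline X ->
  (forall M, c <= M -> (integral_of (band c M) X <= B)%E) ->
  (integral_of (excess c) X <= B)%E.
Proof.
move=> c0 mX X0 XB.
pose g n x := (band c (c + n%:R) (X x))%:E.
have mg n : measurable_fun (`]0, +oo[%classic : set (lebesgueType R)) (g n).
  by apply: measurable_comp_halfline => //; exact: hf_measurable (height_band _ c0).
have g0 n x : (`]0, +oo[%classic : set (lebesgueType R)) x -> (0 <= g n x)%E.
  by move=> _; rewrite lee_fin band_ge0.
have ndg x : (`]0, +oo[%classic : set (lebesgueType R)) x ->
    {homo g^~ x : n m / (n <= m)%N >-> (n <= m)%E}.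
  move=> _ n m nm; rewrite lee_fin; apply: le_band => //.
  by rewrite lerD2l ler_nat.
have gE x : limn (g^~ x) = (excess c (X x))%:E.
  apply/cvg_lim => //; apply: cvg_near_cst.
  near=> n; congr (_%:E); have Xn : X x - c <= n%:R.
    by near: n; exact: nbhs_infty_ger.
  have [Xc|cX] := leP (X x) c; first by rewrite band_low// excess_out.
  by rewrite band_mid ?excess_in ?(ltW cX)//; lra.
have cvI := @cvg_monotone_convergence _ _ _ mu _ measurable_halfline g mg g0 ndg.
rewrite [leLHS](_ : _ = \int[mu]_(x in `]0%R, +oo[) limn (g^~ x))%E; last first.
  by apply: eq_integral => x _; rewrite gE.
rewrite -(cvg_lim _ cvI)//.
apply: lime_le; first by apply/cvg_ex; eexists; exact: cvI.
by near=> n; apply: XB; rewrite lerDl.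
Unshelve. all: by end_near. Qed.

(** Since [phi] vanishes below [r], only the initial interval on which [star X > r]
contributes. On such an interval truncated expressions agree with untruncated ones,
and this is where integral inequalities over [(0, t)] can be used. *)
Lemma integral_star_levels phi X r (B : \bar R) : height_function phi ->
  lebesgue_measurable X -> finite_star X -> 0 <= r ->
  (forall x, 0 <= x -> x <= r -> phi x = 0) -> (0 <= B)%E ->
  (forall t, 0 < t -> (forall s, 0 < s -> s < t -> r < fine (star X s)) ->
    (\int[leb]_(s in `]0%R, t[) (phi (fine (star X s)))%:E <= B)%E) ->
  (\int[leb]_(s in `]0%R, +oo[) (phi (fine (star X s)))%:E <= B)%E.
Proof.
move=> hphi mX fX r0 phir B0 H.
set F := fun s => (phi (fine (star X s)))%:E.
have rX s : 0 < s -> (r < fine (star X s)) <-> (s%:E < level_measure X r)%E.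
  by move=> s0; rewrite -lte_fin fine_starK//; exact: lt_star.
have : (0 <= level_measure X r)%E by exact: measure_ge0.
case dE : (level_measure X r) => [d| |] //; last first.
  move=> _.
  have -> : (`]0, +oo[%classic : set (measurableTypeR R)) =
      \bigcup_n (`]0, n%:R[%classic : set (measurableTypeR R)).
    apply/seteqP; split => s /=.
      rewrite in_itv/= andbT => s0; exists (Num.truncn s).+1 => //=.
      by rewrite in_itv/= s0 truncnS_gt.
    by move=> [n _]/=; rewrite !in_itv/= andbT => /andP[].
  have cvI : (\int[leb]_(s in `]0%R, n%:R[) F s)%E @[n --> \oo] -->
      (\int[leb]_(s in \bigcup_n (`]0%R, n%:R[%classic : set (measurableTypeR R))) F s)%E.
    apply: ge0_nondecreasing_set_cvg_integral => //.
    - move=> n m nm; apply/subsetPset => s /=; rewrite !in_itv/= => /andP[-> sn] /=.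
      by rewrite (lt_le_trans sn)// ler_nat.
    - move=> n; apply/measurable_EFinP; apply: measurableT_comp.
        exact: hf_measurable hphi.
      exact: measurable_fine_star.
    - by move=> n s _; rewrite lee_fin (hf_ge0 hphi)// fine_ge0// star_ge0.
  rewrite -(cvg_lim _ cvI)//; apply: lime_le.
    by apply/cvg_ex; eexists; exact: cvI.
  near=> n; apply: H => [|s s0 _]; last by rewrite rX// dE ltry.
  by near: n; exact: nbhs_infty_gtr.
rewrite lee_fin => d0.
rewrite [leLHS](_ : _ = (\int[leb]_(s in `]0%R, d[) F s)%E); last first.
  rewrite integral_mkcond [RHS]integral_mkcond; apply: eq_integral => s _.
  rewrite !patchE; have [s0|s0] := ltP 0 s; last first.
    by rewrite !memNset//= in_itv/= ?(ltNge 0) s0.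
  rewrite mem_set/= ?in_itv/= ?andbT//.
  case: ifPn => //; rewrite notin_setE/= in_itv/= s0/= => /negP; rewrite -leNgt => ds.
  rewrite /F phir ?fine_ge0 ?star_ge0// leNgt; apply/negP => /(rX _ s0).
  by rewrite dE lte_fin ltNge ds.
move: d0; rewrite le_eqVlt => /orP[/eqP<-|d0].
  by rewrite set_itvoo0 integral_set0.
by apply: H => // s s0 sd; rewrite rX// dE lte_fin.
Unshelve. all: by end_near. Qed.

End integrals.

(** * Submajorization in terms of truncations *)

Section submajorization.
Context {R : realType}.
Implicit Types (X Y phi psi : R -> R) (s t r c M A q : R).
Local Notation mu := (@completed_lebesgue_measure R).
Local Notation leb := (@lebesgue_measure R).

Lemma measurable_height_star phi X (b : itv_bound R) : height_function phi ->
  finite_star X ->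
  measurable_fun ([set` Interval (BRight 0) b] : set (measurableTypeR R))
    (fun s => (phi (fine (star X s)))%:E).
Proof.
move=> hphi fX; apply/measurable_EFinP; apply: measurableT_comp.
  exact: hf_measurable hphi.
exact: measurable_fine_star.
Qed.

Lemma height_star_ge0 phi X s : height_function phi ->
  (0 <= (phi (fine (star X s)))%:E)%E.
Proof. by move=> hphi; rewrite lee_fin (hf_ge0 hphi)// fine_ge0// star_ge0. Qed.

Lemma integral_of_le_star phi X Y : height_function phi ->
  lebesgue_measurable X -> nonneg_on_halfline X ->
  lebesgue_measurable Y -> nonneg_on_halfline Y -> finite_star Y ->
  (forall t, 0 < t -> (star X t <= star Y t)%E) ->
  (integral_of phi X <= integral_of phi Y)%E.
Proof.
move=> hphi mX X0 mY Y0 fY XY.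
have fX : finite_star X by move=> t t0; apply: le_lt_trans (XY _ t0) (fY _ t0).
rewrite -(integral_of_star hphi mX X0 fX) -(integral_of_star hphi mY Y0 fY).
apply: ge0_le_integral.
- exact: measurable_itv.
- by move=> s _; exact: height_star_ge0.
- exact: measurable_height_star.
- exact: measurable_height_star.
- move=> s /=; rewrite in_itv/= andbT => s0; rewrite lee_fin.
  apply: height_homo => //; first by rewrite fine_ge0// star_ge0.
  by rewrite -lee_fin !fine_starK// XY.
Qed.

Lemma integral_star_split X t c : finite_star X -> 0 < t -> 0 <= c ->
  (\int[leb]_(s in `]0%R, t[) (c + excess c (fine (star X s)))%:E =
   (t * c)%:E + \int[leb]_(s in `]0%R, t[) (excess c (fine (star X s)))%:E)%E.
Proof.
move=> fX t0 c0.
under eq_integral do rewrite EFinD.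
rewrite ge0_integralD//=.
- by congr (_ + _)%E; rewrite integral_cst//= lebesgue_measure_itv/= lte_fin t0 oppr0 adde0 -EFinM mulrC.
- by move=> s _; apply: height_star_ge0; exact: height_excess.
- by apply: measurable_height_star => //; exact: height_excess.
Qed.

(** The easy half of the K-functional formula: [x <= c + (x - c)^+]. *)
Lemma integral_star_le X t c : lebesgue_measurable X -> nonneg_on_halfline X ->
  finite_star X -> 0 < t -> 0 <= c ->
  (\int[leb]_(s in `]0%R, t[) star X s <= (t * c)%:E + integral_of (excess c) X)%E.
Proof.
move=> mX X0 fX t0 c0.
apply: (@le_trans _ _ (\int[leb]_(s in `]0%R, t[) (c + excess c (fine (star X s)))%:E)%E).
  apply: ge0_le_integral => //.
  - by move=> s _; exact: star_ge0.
  - exact: measurable_star.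
  - apply/measurable_EFinP; apply: measurable_funD => //.
    by apply/measurable_EFinP; apply: measurable_height_star => //; exact: height_excess.
  - move=> s /=; rewrite in_itv/= => /andP[s0 _]; rewrite -fine_starK// lee_fin.
    by rewrite -lerBlDl /excess le_max lexx.
rewrite integral_star_split// leeD2l//.
rewrite -integral_of_star//; last exact: height_excess.
apply: ge0_subset_integral => //.
- by apply: measurable_height_star => //; exact: height_excess.
- by move=> s _; apply: height_star_ge0; exact: height_excess.
- by move=> s /=; rewrite !in_itv/= andbT => /andP[].
Qed.

(** The infimum in the K-functional formula is attained at [c = star X t], because
[star X <= c] after [t]. *)
Lemma integral_star_eq X t : lebesgue_measurable X -> nonneg_on_halfline X ->
  finite_star X -> 0 < t ->
  (\int[leb]_(s in `]0%R, t[) star X s =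
   (t * fine (star X t))%:E + integral_of (excess (fine (star X t))) X)%E.
Proof.
move=> mX X0 fX t0; set c := fine (star X t).
have c0 : 0 <= c by rewrite fine_ge0// star_ge0.
have cX s : 0 < s -> s <= t -> c <= fine (star X s).
  by move=> s0 st; rewrite -lee_fin !fine_starK//; exact: star_nonincreasing.
apply/eqP; rewrite eq_le integral_star_le//=.
rewrite -integral_of_star//; last exact: height_excess.
rewrite [leRHS](_ : _ = (t * c)%:E +
    \int[leb]_(s in `]0%R, t[) (excess c (fine (star X s)))%:E)%E; last first.
  rewrite -integral_star_split//; apply: eq_integral => s.
  rewrite inE/= in_itv/= => /andP[s0 st]; rewrite -fine_starK//; congr (_%:E).
  by rewrite excess_in ?cX ?(ltW st)// subrKC.
rewrite leeD2l// integral_mkcond [leRHS]integral_mkcond.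
rewrite le_eqVlt; apply/orP; left; apply/eqP; apply: eq_integral => s _.
rewrite !patchE; have [s0|s0] := ltP 0 s; last first.
  by rewrite !memNset//= in_itv/= ?(ltNge 0) s0.
rewrite mem_set/= ?in_itv/= ?andbT//.
case: ifPn => //; rewrite notin_setE/= in_itv/= s0/= => /negP; rewrite -leNgt => ts.
rewrite excess_out// -lee_fin !fine_starK//; exact: star_nonincreasing.
Qed.

(** At level [A c] use the submajorization on the interval where [star X > A c]: there
[\int (star X - A c)] is [\int star X - t A c], which the K-functional bound for [Y] at
level [c] controls. *)
Lemma excess_le_of_submajorized X Y A c : lebesgue_measurable X -> nonneg_on_halfline X ->
  finite_star X -> lebesgue_measurable Y -> nonneg_on_halfline Y -> finite_star Y ->
  0 < A -> 0 <= c ->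
  (forall t, 0 < t -> (\int[leb]_(s in `]0%R, t[) star X s <=
                       A%:E * \int[leb]_(s in `]0%R, t[) star Y s)%E) ->
  (integral_of (excess (A * c)) X <= A%:E * integral_of (excess c) Y)%E.
Proof.
move=> mX X0 fX mY Y0 fY A0 c0 XY; have Ac0 : 0 <= A * c by rewrite mulr_ge0// ltW.
rewrite -integral_of_star//; last exact: height_excess.
apply: (integral_star_levels (r := A * c)) => //.
- exact: height_excess.
- by move=> x _; exact: excess_out.
- by rewrite mule_ge0 ?lee_fin ?(ltW A0)// integral_of_ge0// => x _; exact: excess_ge0.
move=> t t0 tX.
have := le_trans (XY _ t0) (lee_wpmul2l _ (integral_star_le mY Y0 fY t0 c0)).
rewrite lee_fin ltW// => /(_ isT).
rewrite [leLHS](_ : _ = (t * (A * c))%:E +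
    \int[leb]_(s in `]0%R, t[) (excess (A * c) (fine (star X s)))%:E)%E; last first.
  rewrite -integral_star_split//; apply: eq_integral => s.
  rewrite inE/= in_itv/= => /andP[s0 st]; rewrite -fine_starK//; congr (_%:E).
  by rewrite excess_in ?(ltW (tX _ _ _))// subrKC.
rewrite ge0_muleDr ?lee_fin ?mulr_ge0 ?(ltW t0)//; last first.
  by rewrite integral_of_ge0// => x _; exact: excess_ge0.
by rewrite -EFinM mulrCA leeD2lE.
Qed.

(** Apply the K-functional inequality for [X] at [A] times the optimal level for [Y]. *)
Lemma submajorized_of_excess_le X Y A t : lebesgue_measurable X -> nonneg_on_halfline X ->
  finite_star X -> lebesgue_measurable Y -> nonneg_on_halfline Y -> finite_star Y ->
  0 < A -> 0 < t -> (0 < star Y t)%E ->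
  (forall c, 0 < c ->
    (integral_of (excess (A * c)) X <= A%:E * integral_of (excess c) Y)%E) ->
  (\int[leb]_(s in `]0%R, t[) star X s <= A%:E * \int[leb]_(s in `]0%R, t[) star Y s)%E.
Proof.
move=> mX X0 fX mY Y0 fY A0 t0 Yt0 XY.
rewrite (integral_star_eq mY)//; set c := fine (star Y t).
have c0 : 0 < c by rewrite fine_gt0// Yt0 fY.
have Ac0 : 0 <= A * c by rewrite mulr_ge0// ltW.
apply: (le_trans (integral_star_le mX X0 fX t0 Ac0)).
rewrite ge0_muleDr ?lee_fin ?mulr_ge0 ?(ltW t0) ?(ltW c0)//; last first.
  by rewrite integral_of_ge0// => x _; exact: excess_ge0.
by rewrite -EFinM (mulrCA A) leeD2l// XY.
Qed.

(** Holds without integrability: positive and negative parts are compared separately. *)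
Lemma le_integral_ereal (D : set (measurableTypeR R)) (f g : R -> \bar R) : measurable D ->
  measurable_fun D f -> measurable_fun D g -> (forall x, D x -> f x <= g x)%E ->
  (\int[leb]_(x in D) f x <= \int[leb]_(x in D) g x)%E.
Proof.
move=> mD mf mg fg; rewrite integralE [leRHS]integralE; apply: leeB.
- apply: ge0_le_integral => //; [exact: measurable_funepos..|].
  move=> x Dx; by rewrite !funeposE ge_max !le_max lexx orbT andbT fg//.
- apply: ge0_le_integral => //; [exact: measurable_funeneg..|].
  by move=> x Dx; rewrite !funenegE ge_max !le_max lexx orbT andbT leeN2 fg.
Qed.

Lemma measurable_lne_star X (b : itv_bound R) :
  measurable_fun ([set` Interval (BRight 0) b] : set (measurableTypeR R))
    (fun s => lne (star X s)).
Proof.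
apply: nonincreasing_emeasurable => s t s0 st.
by rewrite lee_lne ?star_nonincreasing// in_itv/= star_ge0 leey.
Qed.

Lemma lne_le_log_excess X s r : finite_star X -> 0 < s -> 0 < r ->
  (lne (star X s) <= (ln r + log_excess r (fine (star X s)))%:E)%E.
Proof.
move=> fX s0 r0; rewrite -[X in lne X](fine_starK fX s0).
set x := fine _; have [x0|x0] := leP x 0.
  by rewrite le0_lneNy ?leNye.
rewrite lne_EFin// lee_fin; have [xr|rx] := leP x r.
  by rewrite log_excess_out ?addr0 ?ler_ln ?posrE// ltW.
by rewrite log_excess_in// ?subrKC// ltW.
Qed.

Lemma integrable_log_excess X t r : finite_star X -> 0 < t -> 0 < r ->
  leb.-integrable `]0, t[ (fun s => lne (star X s))^\+%E ->
  leb.-integrable `]0, t[ (fun s => (log_excess r (fine (star X s)))%:E).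
Proof.
move=> fX t0 r0 iX.
have ic : leb.-integrable `]0, t[ (cst `|ln r|%:E).
  by apply/integrableP; split => //; rewrite integral_cst//= lebesgue_measure_itv/= lte_fin t0
    oppr0 adde0 -EFinM ltry.
apply: le_integrable (integrableD _ iX ic) => //.
  by apply: measurable_height_star => //; exact: height_log_excess.
move=> s /=; rewrite in_itv/= => /andP[s0 _].
rewrite ger0_norm ?log_excess_ge0// gee0_abs ?adde_ge0//.
rewrite /= funeposE -[X in lne X](fine_starK fX s0); set x := fine (star X s).
have [xr|rx] := leP x r.
  by rewrite log_excess_out ?adde_ge0 ?le_max ?lexx ?orbT// fine_ge0// star_ge0.
rewrite log_excess_in ?(ltW rx)// lne_EFin ?(lt_trans r0)//.
rewrite EFinB leeD// ?le_max ?lexx//.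
by rewrite -EFinN lee_fin -normrN ler_norm.
Qed.

(** The weak majorization principle for the convex function [(y - ln r)^+] of [y = log x]:
on the interval where [star X > r] the truncated logarithm equals [lne - ln r], and on
the side of [Y] truncation only increases the integral. *)
Lemma log_excess_le_of_log_submajorized X Y r :
  lebesgue_measurable X -> nonneg_on_halfline X -> finite_star X ->
  lebesgue_measurable Y -> nonneg_on_halfline Y -> finite_star Y ->
  (forall t, 0 < t -> leb.-integrable `]0, t[ (fun s => lne (star X s))^\+%E) ->
  (forall t, 0 < t -> leb.-integrable `]0, t[ (fun s => lne (star Y s))^\+%E) ->
  (forall t, 0 < t -> (\int[leb]_(s in `]0%R, t[) lne (star X s) <=
                       \int[leb]_(s in `]0%R, t[) lne (star Y s))%E) ->
  0 < r ->
  (integral_of (log_excess r) X <= integral_of (log_excess r) Y)%E.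
Proof.
move=> mX X0 fX mY Y0 fY iX iY XY r0.
rewrite -integral_of_star//; last exact: height_log_excess.
apply: (integral_star_levels (r := r)) => //; first exact: height_log_excess.
- exact: ltW.
- by move=> x x0 xr; exact: log_excess_out.
- by rewrite integral_of_ge0// => x _; exact: log_excess_ge0.
move=> t t0 tX.
have intD Z : finite_star Z -> leb.-integrable `]0, t[ (fun s => lne (star Z s))^\+%E ->
    (\int[leb]_(s in `]0%R, t[) (ln r + log_excess r (fine (star Z s)))%:E =
    (t * ln r)%:E + \int[leb]_(s in `]0%R, t[) (log_excess r (fine (star Z s)))%:E)%E.
  move=> fZ iZ; under eq_integral do rewrite EFinD.
  rewrite integralD//=.
  - by congr (_ + _)%E; rewrite integral_cst//= lebesgue_measure_itv/= lte_fin t0 oppr0 adde0 -EFinM mulrC.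
  - apply/integrableP; split => //; rewrite integral_cst//= lebesgue_measure_itv/= lte_fin t0.
    by rewrite oppr0 adde0 -EFinM ltry.
  - exact: integrable_log_excess.
have : (\int[leb]_(s in `]0%R, t[) (ln r + log_excess r (fine (star X s)))%:E <=
        \int[leb]_(s in `]0%R, t[) (ln r + log_excess r (fine (star Y s)))%:E)%E.
  apply: (@le_trans _ _ (\int[leb]_(s in `]0%R, t[) lne (star X s))%E).
    rewrite le_eqVlt; apply/orP; left; apply/eqP; apply: eq_integral => s.
    rewrite inE/= in_itv/= => /andP[s0 st].
    have rx := tX _ s0 st; rewrite -[X in lne X](fine_starK fX s0) lne_EFin ?(lt_trans r0)//.
    by rewrite log_excess_in ?(ltW rx)// subrKC.
  apply: (le_trans (XY _ t0)); apply: le_integral_ereal => //.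
  - exact: measurable_lne_star.
  - apply/measurable_EFinP; apply: measurable_funD => //.
    by apply/measurable_EFinP; apply: measurable_height_star => //; exact: height_log_excess.
  - by move=> s /=; rewrite in_itv/= => /andP[s0 _]; exact: lne_le_log_excess.
rewrite !intD//; [|exact: iY|exact: iX].
rewrite leeD2lE// => /le_trans; apply.
rewrite -integral_of_star//; last exact: height_log_excess.
apply: ge0_subset_integral => //.
- by apply: measurable_height_star => //; exact: height_log_excess.
- by move=> s _; apply: height_star_ge0; exact: height_log_excess.
- by move=> s /=; rewrite !in_itv/= andbT => /andP[].
Qed.

End submajorization.

(** * Consequences of logarithmic submajorization *)

Section log_comparison.
Context {R : realType}.
Implicit Types (X Y phi psi : R -> R) (s t r c M N A q : R).
Local Notation mu := (@completed_lebesgue_measure R).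
Local Notation leb := (@lebesgue_measure R).

Lemma measurable_log_comb c q m : 0 < c -> 0 < q ->
  measurable_fun [set: R] (log_comb c q m).
Proof.
move=> c0 q0; elim: m => [|m IH] /=.
  by apply: measurable_funM => //; exact: hf_measurable (height_log_excess c0).
apply: measurable_funD => //; apply: measurable_funM => //.
by apply: hf_measurable (height_log_excess _); rewrite mulr_gt0 ?exprn_gt0.
Qed.

Lemma log_comb_ge0 c q m x : 0 < c -> 1 < q -> 0 <= log_comb c q m x.
Proof.
move=> c0 q1; elim: m => [|m IH] /=; first by rewrite mulr_ge0 ?log_excess_ge0 ?ltW.
rewrite addr_ge0// mulr_ge0 ?log_excess_ge0// subr_ge0 ler_pM2l// exprS.
by rewrite ler_peMl ?(ltW q1)// exprn_ge0//; lra.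
Qed.

Section comparison.
Variables (X Y : R -> R).
Hypotheses (mX : lebesgue_measurable X) (X0 : nonneg_on_halfline X).
Hypotheses (mY : lebesgue_measurable Y) (Y0 : nonneg_on_halfline Y).
Hypothesis XY : forall r, 0 < r ->
  (integral_of (log_excess r) X <= integral_of (log_excess r) Y)%E.

Lemma integral_log_comb_le c q m : 0 < c -> 1 < q ->
  (integral_of (log_comb c q m) X <= integral_of (log_comb c q m) Y)%E.
Proof.
move=> c0 q1; have q0 : 0 < q by lra.
have combE Z : lebesgue_measurable Z -> nonneg_on_halfline Z -> forall n,
    integral_of (log_comb c q n) Z =
    (if n is n'.+1 then integral_of (log_comb c q n') Z +
      (c * q ^+ n'.+1 - c * q ^+ n')%:E * integral_of (log_excess (c * q ^+ n')) Z
    else c%:E * integral_of (log_excess c) Z)%E.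
  move=> mZ Z0 [|n].
    rewrite -[RHS]adde0 -[X in (_ + X)%E](mul0e (integral_of (log_excess c) Z)).
    rewrite -integral_ofD//; first by congr integral_of; apply/funext => x /=; ring.
    - exact: hf_measurable (height_log_excess c0).
    - exact: hf_measurable (height_log_excess c0).
    - by move=> x _; exact: log_excess_ge0.
    - by move=> x _; exact: log_excess_ge0.
    - exact: ltW.
  rewrite -[X in (X + _)%E]mul1e -integral_ofD//.
  - by congr integral_of; apply/funext => x /=; ring.
  - exact: measurable_log_comb.
  - by apply: hf_measurable (height_log_excess _); rewrite mulr_gt0 ?exprn_gt0.
  - by move=> x _; exact: log_comb_ge0.
  - by move=> x _; exact: log_excess_ge0.
  - by rewrite subr_ge0 ler_pM2l// exprS ler_peMl ?(ltW q1)// exprn_ge0// ltW.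
elim: m => [|m IH]; rewrite (combE _ mX X0) (combE _ mY Y0).
  by rewrite lee_wpmul2l ?lee_fin ?(ltW c0)// XY.
apply: leeD => //; rewrite lee_wpmul2l ?XY ?mulr_gt0 ?exprn_gt0//.
by rewrite lee_fin subr_ge0 ler_pM2l// exprS ler_peMl ?(ltW q1)// exprn_ge0// ltW.
Qed.

Lemma exists_grid_point c q M : 0 < c -> 1 < q -> c <= M ->
  exists m, M <= c * q ^+ m /\ c * q ^+ m <= q * M.
Proof.
move=> c0 q1 cM; have q0 : 0 < q by lra.
have ex : exists m, M <= c * q ^+ m.
  have : (q^-1) ^+ n @[n --> \oo] --> (0 : R).
    by apply: cvg_expr; rewrite ger0_norm ?invr_ge0 ?ltW// invf_lt1.
  have M0 := lt_le_trans c0 cM.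
  move=> /cvgrPdist_lt /(_ _ (divr_gt0 c0 M0))[n _ /(_ n (leqnn n))].
  rewrite /= sub0r normrN ger0_norm ?exprn_ge0 ?invr_ge0 ?(ltW q0)// exprVn => h.
  exists n; rewrite -ler_pdivrMr ?exprn_gt0//; move: h.
  by rewrite ltr_pdivlMr// mulrC => /ltW.
pose m := ex_minn ex; exists m; rewrite /m; case: ex_minnP => {}m Mm mmin.
split => //; case: m Mm mmin => [|m] Mm mmin.
  by rewrite expr0 mulr1; apply: (le_trans cM); rewrite ler_peMl ?(ltW q1)// (le_trans (ltW c0)).
have : ~~ (M <= c * q ^+ m) by apply/negP => /mmin; rewrite ltnn.
by rewrite -ltNge exprS mulrCA ler_pM2l// => /ltW.
Qed.

(** The main effect of logarithmic submajorization: mass in a window of heights is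
controlled by mass in a slightly longer window, up to a factor close to one. *)
Lemma band_le_of_log c q M N : 0 < c -> 1 < q -> c <= M -> q * M <= N ->
  (integral_of (band c M) X <=
   q%:E * integral_of (band c N) Y + (q * M / N)%:E * integral_of (excess N) Y)%E.
Proof.
move=> c0 q1 cM MN; have q0 : 0 < q by lra.
have M0 := lt_le_trans c0 cM; have N0 : 0 < N by rewrite (lt_le_trans _ MN)// mulr_gt0.
have [m [Mm mM]] := exists_grid_point c0 q1 cM.
have mb := hf_measurable (height_band N (ltW c0)).
have me := hf_measurable (height_excess (ltW N0)).
apply: (@le_trans _ _ (integral_of (log_comb c q m) X)).
  apply: le_integral_of => //; first exact: hf_measurable (height_band M (ltW c0)).
    exact: measurable_log_comb.
  move=> x x0; rewrite band_ge0/=; apply: le_trans (log_comb_lower m c0 q1 (X0 x0)).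
  apply: (le_trans (le_band _ (lexx c) Mm)).
  by rewrite lerDl mulr_ge0 ?log_excess_ge0// mulr_ge0 ?exprn_ge0// ltW.
apply: (le_trans (integral_log_comb_le m c0 q1)).
rewrite -integral_ofD//; [|by move=> x _; exact: band_ge0|
  by move=> x _; exact: excess_ge0|exact: ltW|by rewrite !mulr_ge0 ?invr_ge0// ltW].
apply: le_integral_of => //; first exact: measurable_log_comb.
  by apply: measurable_funD; apply: measurable_funM.
move=> x x0; rewrite log_comb_ge0//=.
apply: (le_trans (log_comb_le c0 q1 (Y0 x0) (le_trans mM MN))).
by rewrite lerD2l ler_wpM2r ?excess_ge0// ler_pM2r ?invr_gt0.
Qed.

(** Take [N = q M] in the window comparison, let [M] tend to infinity, then [q] to one. *)
Lemma excess_le_of_log c : 0 < c ->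
  (integral_of (excess c) X <= integral_of (excess c) Y)%E.
Proof.
move=> c0.
have qXY q : 1 < q -> (integral_of (excess c) X <= q%:E * integral_of (excess c) Y)%E.
  move=> q1; have q0 : 0 < q by lra.
  apply: integral_excess_le => //; first exact: ltW.
  move=> M cM; have M0 := lt_le_trans c0 cM.
  have qM0 : 0 < q * M by rewrite mulr_gt0.
  have cqM : c <= q * M by rewrite (le_trans cM)// ler_peMl ?(ltW M0)// ltW.
  apply: (le_trans (band_le_of_log c0 q1 cM (lexx _))).
  rewrite divff ?gt_eqF//.
  have -> : integral_of (excess c) Y =
      (1%:E * integral_of (band c (q * M)) Y + 1%:E * integral_of (excess (q * M)) Y)%E.
    rewrite -integral_ofD//.
    - by congr integral_of; apply/funext => x; rewrite !mul1r -excessD.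
    - exact: hf_measurable (height_band _ (ltW c0)).
    - exact: hf_measurable (height_excess (ltW qM0)).
    - by move=> x _; exact: band_ge0.
    - by move=> x _; exact: excess_ge0.
  have E0 : (0 <= integral_of (excess (q * M)) Y)%E.
    by apply: integral_of_ge0 => // x _; exact: excess_ge0.
  have B0 : (0 <= integral_of (band c (q * M)) Y)%E.
    by apply: integral_of_ge0 => // x _; exact: band_ge0.
  rewrite !mul1e (ge0_muleDr _ B0 E0) leeD2l// -[leLHS]mul1e lee_wpmul2r//.
  by rewrite lee_fin ltW.
have : (0 <= integral_of (excess c) Y)%E.
  by rewrite integral_of_ge0// => x _; exact: excess_ge0.
case YE : (integral_of (excess c) Y) => [y| |] // y0; last by rewrite leey.
apply/lee_addgt0Pr => e e0.
have y1 : 0 < y + 1 by rewrite ltr_wpDl.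
have h : 1 < 1 + e / (y + 1) by rewrite ltrDl divr_gt0.
apply: (le_trans (qXY _ h)); rewrite YE -EFinM -EFinD lee_fin.
rewrite mulrDl mul1r lerD2l -mulrA ler_piMr ?(ltW e0)// ler_pdivrMl// mulr1.
by rewrite lerDl.
Qed.

End comparison.
End log_comparison.

(** * Step functions *)

(** The function [\sum_n 2^n / t_n 1_(0, t_n)]; its [n]-th piece has mass [2^n]. *)
Definition steps (R : realType) (t : nat -> R) (x : R) : R :=
  fine (\sum_(n <oo) (2 ^+ n / t n * (x < t n)%R%:R)%:E)%E.

Section steps_theory.
Context {R : realType}.
Local Notation mu := (@completed_lebesgue_measure R).
Local Notation leb := (@lebesgue_measure R).

Lemma nneseries_le_geometric (u : nat -> R) (C : R) : 0 <= C ->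
  (forall n, 0 <= u n <= C / 2 ^+ n.+1) -> (\sum_(n <oo) (u n)%:E <= C%:E)%E.
Proof.
move=> C0 uC; apply: le_trans (epsilon_trick0 xpredT C0).
apply: lee_nneseries => [n _ _|n _]; first by rewrite lee_fin; case/andP: (uC n).
by rewrite lee_fin natrX; case/andP: (uC n).
Qed.

Lemma nonincreasing_lebesgue_measurable (F : R -> R) :
  {homo F : x y /~ y <= x} -> lebesgue_measurable F.
Proof.
move=> ndF _ Y mY; apply: sub_caratheodory.
have mD : measurable (`]0%R, +oo[%classic : set (measurableTypeR R)) by exact: measurable_itv.
exact: (nonincreasing_measurable mD ndF mD mY).
Qed.

Variable t : nat -> R.
Hypothesis tP : forall n, 4 ^+ n <= t n.

Lemma steps_point_gt0 n : 0 < t n.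
Proof. by apply: lt_le_trans (tP n); rewrite exprn_gt0. Qed.

Lemma step_ge0 n x : 0 <= 2 ^+ n / t n * (x < t n)%R%:R.
Proof. by rewrite !mulr_ge0 ?invr_ge0 ?exprn_ge0// ltW// steps_point_gt0. Qed.

Lemma step_coef_le n : 2 ^+ n / t n <= 2 / 2 ^+ n.+1.
Proof.
rewrite ler_pdivrMr ?steps_point_gt0//; apply: le_trans (ler_wpM2l _ (tP n)); last first.
  by rewrite divr_ge0// exprn_ge0.
rewrite (_ : 4 = 2 * 2)%R; last by rewrite -natrM.
by rewrite exprMn exprS invfM !mulrA divff// mul1r mulVf ?mul1r// expf_neq0.
Qed.

Lemma stepsE x : (steps t x)%:E = (\sum_(n <oo) (2 ^+ n / t n * (x < t n)%R%:R)%:E)%E.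
Proof.
rewrite /steps fineK// ge0_fin_numE; last by apply: nneseries_ge0 => n _ _; rewrite lee_fin step_ge0.
apply: (@le_lt_trans _ _ (2%:E : \bar R)%E); last exact: ltry.
apply: nneseries_le_geometric => // n; rewrite step_ge0/=.
apply: le_trans (step_coef_le n); rewrite ler_piMr//; last by case: ltP.
by rewrite divr_ge0 ?exprn_ge0// ltW// steps_point_gt0.
Qed.

Lemma steps_ge0 x : 0 <= steps t x.
Proof. by rewrite -lee_fin stepsE; apply: nneseries_ge0 => n _ _; rewrite lee_fin step_ge0. Qed.

Lemma steps_nonincreasing : {homo steps t : x y /~ y <= x}.
Proof.
move=> y x xy; rewrite -lee_fin !stepsE; apply: lee_nneseries => n.
  by rewrite lee_fin step_ge0.
move=> _; rewrite lee_fin ler_wpM2l ?divr_ge0 ?exprn_ge0//; first by rewrite ltW// steps_point_gt0.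
by rewrite ler_nat; case: (ltP x) => // xt; rewrite (le_lt_trans xy xt).
Qed.

Lemma steps_le2 x : steps t x <= 2.
Proof.
rewrite -lee_fin stepsE; apply: nneseries_le_geometric => // n; rewrite step_ge0/=.
apply: le_trans (step_coef_le n); rewrite ler_piMr//; last by case: ltP.
by rewrite divr_ge0 ?exprn_ge0// ltW// steps_point_gt0.
Qed.

Lemma steps_ge n x : x < t n -> 2 ^+ n / t n <= steps t x.
Proof.
move=> xt; rewrite -lee_fin stepsE.
apply: le_trans (nneseries_lim_ge n.+1 _); last by move=> m _ _; rewrite lee_fin step_ge0.
rewrite big_mkord big_ord_recr/= xt mulr1 leeDr// sume_ge0// => m _.
by rewrite lee_fin step_ge0.
Qed.

Lemma steps_gt0 x : 0 < steps t x.
Proof.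
have [n xn] : exists n, x < t n.
  have [n xn] : exists n : nat, x < n%:R by exists (Num.truncn `|x|).+1;
    apply: le_lt_trans (ler_norm _) _; rewrite truncnS_gt.
  exists n; apply: (lt_le_trans xn); apply: le_trans (tP n).
  by rewrite -natrX ler_nat ltnW// ltn_expl.
apply: lt_le_trans (steps_ge xn); by rewrite divr_gt0 ?exprn_gt0// steps_point_gt0.
Qed.

Lemma steps_measurable : lebesgue_measurable (steps t).
Proof. exact/nonincreasing_lebesgue_measurable/steps_nonincreasing. Qed.

(** Steps with strict inequalities make the function right continuous, hence equal to its
rearrangement at every point. *)
Lemma star_steps x : 0 < x -> star (steps t) x = (steps t x)%:E.
Proof.
move=> x0; apply/eqP; rewrite eq_le; apply/andP; split.
  apply: star_le; first exact: steps_ge0.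
  apply: (@le_trans _ _ (leb `]0, x[%classic)).
    apply: le_outer_measure => y [y0 xy]; rewrite /= in_itv/= y0/=.
    by rewrite ltNge; apply/negP => /steps_nonincreasing; rewrite leNgt xy.
  by rewrite lebesgue_measure_itv/= lte_fin x0 oppr0 adde0.
apply/lee_addgt0Pr => e e0; rewrite -leeBlDr// -EFinB.
have [s0|s0] := ltP (steps t x - e) 0.
  by apply: le_trans (star_ge0 _ _); rewrite lee_fin ltW.
apply: ltW; apply/lt_star => //; first exact: steps_measurable.
(* Finitely many pieces already exceed [s] at [x]; they stay constant up to the next of
   their endpoints, so [steps t] exceeds [s] on an interval longer than [x]. *)
set s := steps t x - e.
have sx : (s%:E < \sum_(n <oo) (2 ^+ n / t n * (x < t n)%R%:R)%:E)%E.
  by rewrite -stepsE lte_fin ltrBlDr ltrDl.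
have cvs := is_cvg_nneseries (fun n (_ : (0 <= n)%N) (_ : xpredT n) =>
  (step_ge0 n x : (0 <= (2 ^+ n / t n * (x < t n)%R%:R)%:E)%E)).
have [N _ /(_ N (leqnn N))/= sN] := cvs _ (open_ereal_gt' sx).
have [y [xy yt]] : exists y, x < y /\ forall n, (n < N)%N -> x < t n -> y <= t n.
  clear; elim: N => [|N [y [xy yt]]]; first by exists (x + 1); rewrite ltrDl.
  have [xN|Nx] := ltP x (t N).
    exists (Num.min y (t N)); rewrite lt_min xy xN; split => // n.
    by rewrite ltnS leq_eqVlt => /orP[/eqP->|nN] xn; rewrite ge_min ?lexx ?orbT// yt.
  exists y; split => // n; rewrite ltnS leq_eqVlt => /orP[/eqP->|nN]; last exact: yt.
  by rewrite ltNge Nx.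
apply: (@lt_le_trans _ _ y%:E); first by rewrite lte_fin.
have y0 := lt_trans x0 xy.
rewrite [leLHS](_ : _ = leb `]0, y[%classic); last first.
  by rewrite lebesgue_measure_itv/= lte_fin y0 oppr0 adde0.
apply: le_outer_measure => z /=; rewrite in_itv/= => /andP[z0 zy]; split => //.
rewrite -lte_fin; apply: (lt_le_trans sN); rewrite stepsE.
apply: le_trans (nneseries_lim_ge N _); last by move=> m _ _; rewrite lee_fin step_ge0.
rewrite !big_mkord; apply: lee_sum => i _; rewrite lee_fin ler_wpM2l ?divr_ge0 ?exprn_ge0//.
  by rewrite ltW// steps_point_gt0.
rewrite ler_nat; case: (ltP x) => // xi.
by rewrite (lt_le_trans zy)// yt.
Qed.

Lemma finite_star_steps : finite_star (steps t).
Proof. by move=> x x0; rewrite star_steps// ltry. Qed.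

Definition primitive_step n (T : R) := 2 ^+ n / t n * Num.min T (t n).

Lemma integral_star_steps T : 0 < T ->
  (\int[leb]_(x in `]0%R, T[) star (steps t) x = \sum_(n <oo) (primitive_step n T)%:E)%E.
Proof.
move=> T0.
transitivity (\int[leb]_(x in `]0%R, T[)
    (\sum_(n <oo) (2 ^+ n / t n * (x < t n)%R%:R)%:E))%E.
  by apply: eq_integral => x; rewrite inE/= in_itv/= => /andP[x0 _]; rewrite star_steps// stepsE.
have coef0 n : 0 <= 2 ^+ n / t n by rewrite divr_ge0 ?exprn_ge0// ltW// steps_point_gt0.
rewrite integral_nneseries//; last 2 first.
- move=> n; apply/measurable_EFinP; apply: measurable_funM => //.
  apply: nonincreasing_measurable => // y x xy.
  by rewrite ler_nat; case: (ltP x) => // xn; rewrite (le_lt_trans xy xn).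
- by move=> n x _; rewrite lee_fin step_ge0.
apply: eq_eseriesr => n _.
under eq_integral do rewrite EFinM.
rewrite ge0_integralZl_EFin//; last first.
  apply/measurable_EFinP; apply: nonincreasing_measurable => // y x xy.
  by rewrite ler_nat; case: (ltP x) => // xn; rewrite (le_lt_trans xy xn).
rewrite /primitive_step [RHS]EFinM; congr (_ * _)%E.
transitivity (\int[leb]_x (\1_(`]0%R, Num.min T (t n)[%classic : set R) x)%:E)%E.
  rewrite integral_mkcond; apply: eq_integral => x _; rewrite patchE indicE; case: ifPn.
    rewrite inE/= in_itv/= => /andP[x0 xT].
    case: (ltP x (t n)) => xn; first by rewrite mem_set//= in_itv/= x0 lt_min xT xn.
    by rewrite memNset//= in_itv/= lt_min [_ < t n]ltNge xn !andbF.
  rewrite notin_setE/= in_itv/= => xN; rewrite memNset//= in_itv/= lt_min.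
  by apply: contra_not xN => /and3P[-> ->].
rewrite integral_indic//= setIT lebesgue_measure_itv/= lte_fin lt_min T0 steps_point_gt0/=.
by rewrite oppr0 adde0.
Qed.

End steps_theory.

(** * The weight and the two extremal functions *)

Section weights.
Context {R : realType}.
Local Notation mu := (@completed_lebesgue_measure R).
Local Notation leb := (@lebesgue_measure R).

(** If [star X] is at most [c] after [T], the window only sees a set of measure [T]. *)
Lemma integral_band_le (X : R -> R) (c M T : R) : lebesgue_measurable X ->
  nonneg_on_halfline X -> finite_star X -> 0 <= c -> 0 <= M -> 0 < T ->
  (star X T <= c%:E)%E -> (integral_of (band c M) X <= (M * T)%:E)%E.
Proof.
move=> mX X0 fX c0 M0 T0 XT; have hb := height_band M c0.
rewrite -integral_of_star//; apply: (integral_star_levels (r := c)) => //.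
- by move=> x _; exact: band_low.
- by rewrite lee_fin mulr_ge0// ltW.
move=> t t0 tX; have tT : t <= T.
  rewrite leNgt; apply/negP => /(tX _ T0).
  by rewrite ltNge -lee_fin fine_starK// XT.
apply: (@le_trans _ _ (\int[leb]_(s in `]0%R, t[) (cst M%:E s))%E).
  apply: ge0_le_integral => //.
  - by move=> s _; exact: height_star_ge0.
  - exact: measurable_height_star.
  - by move=> s _; rewrite lee_fin /band ge_max M0 andbT lerBlDr ge_min lerDl c0 orbT.
rewrite integral_cst//= lebesgue_measure_itv/= lte_fin t0 oppr0 adde0 -EFinM lee_fin.
by rewrite ler_wpM2l.
Qed.

(** The endpoints [t_n] of the pieces of [f]. The quadratic exponent makes the gap between
the values [2^(- 2 n^2)] of consecutive pieces wider than any fixed factor. *)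
Definition jump_point (n : nat) : R := 2 ^+ (2 * n * n + n).
(** The endpoints [s_n = 2^n / a_n] of the pieces of [g], chosen to bring the value of the
[n]-th piece down to [a_n]. *)
Definition spread_point (n : nat) : R := 2 ^+ (2 * n * n + 2 * n).
(** The heights [a_n] around which flatness is tested. *)
Definition probe (n : nat) : R := (jump_point n)^-1.

Lemma four_pow_le (n m : nat) : (2 * n <= m)%N -> 4 ^+ n <= 2 ^+ m :> R.
Proof.
move=> nm; rewrite (_ : 4 = 2 ^+ 2)%R; last by rewrite expr2 -natrM.
by rewrite -exprM ler_eXn2l// ltr1n.
Qed.

Lemma jump_pointP n : 4 ^+ n <= jump_point n.
Proof. by apply: four_pow_le; nia. Qed.
Lemma spread_pointP n : 4 ^+ n <= spread_point n.
Proof. by apply: four_pow_le; lia. Qed.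
Lemma jump_point_gt0 n : 0 < jump_point n. Proof. exact: exprn_gt0. Qed.
Lemma spread_point_gt0 n : 0 < spread_point n. Proof. exact: exprn_gt0. Qed.
Lemma probe_gt0 n : 0 < probe n. Proof. by rewrite invr_gt0 jump_point_gt0. Qed.

Lemma spread_coef n : 2 ^+ n / spread_point n = probe n.
Proof.
rewrite /probe /jump_point /spread_point (_ : 2 * n * n + 2 * n = n + (2 * n * n + n))%N; last by lia.
by rewrite exprD invfM mulrA divff ?mul1r// expf_neq0.
Qed.

(** The spare factor [2^n] makes the later pieces of [f] negligible at height [a_n]. *)
Lemma jump_coef_tail n m : (n < m)%N -> 2 ^+ m / jump_point m <= probe n / 2 ^+ n / 2 ^+ m.+1.
Proof.
move=> nm; rewrite /probe /jump_point -!invfM -!exprD.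
rewrite (_ : 2 ^+ m / 2 ^+ (2 * m * m + m) = (2 ^+ (2 * m * m))^-1); last first.
  by rewrite addnC exprD invfM mulrA divff ?mul1r// expf_neq0.
by rewrite lef_pV2 ?posrE ?exprn_gt0// ler_eXn2l ?ltr1n//; nia.
Qed.

Definition lacunary := steps jump_point.
Definition spread := steps spread_point.

Lemma lacunary_tail n x : jump_point n <= x -> lacunary x <= probe n / 2 ^+ n.
Proof.
move=> nx; rewrite -lee_fin stepsE; last exact: jump_pointP.
apply: nneseries_le_geometric => [|m].
  by rewrite divr_ge0 ?exprn_ge0// ltW// probe_gt0.
rewrite step_ge0/=; last exact: jump_pointP.
case: (ltP x) => xm; rewrite ?mulr1 ?mulr0; last first.
  by rewrite !divr_ge0 ?exprn_ge0// ltW// probe_gt0.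
apply: jump_coef_tail; rewrite ltnNge; apply/negP => mn.
have := le_lt_trans nx xm; rewrite ltNge /jump_point ler_eXn2l ?ltr1n//.
by move/negP; apply; nia.
Qed.

Definition psi (T : R) : R := fine (\sum_(n <oo) (primitive_step jump_point n T)%:E)%E.

Lemma primitive_step_ge0 n T : 0 <= T -> 0 <= primitive_step jump_point n T.
Proof.
move=> T0; rewrite /primitive_step mulr_ge0 ?divr_ge0 ?exprn_ge0//.
by rewrite le_min T0 exprn_ge0.
Qed.

Lemma psi_series_le T : 0 <= T ->
  (\sum_(n <oo) (primitive_step jump_point n T)%:E <= (2 * T)%:E)%E.
Proof.
move=> T0; apply: nneseries_le_geometric => [|n]; first by rewrite mulr_ge0.
rewrite primitive_step_ge0//= /primitive_step [leRHS]mulrAC.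
apply: ler_pM.
- by rewrite divr_ge0 ?exprn_ge0 ?(ltW (jump_point_gt0 n)).
- by rewrite le_min T0 ltW ?jump_point_gt0.
- exact: (step_coef_le jump_pointP n).
- by rewrite ge_min lexx.
Qed.

Lemma psiE T : 0 <= T -> (psi T)%:E = (\sum_(n <oo) (primitive_step jump_point n T)%:E)%E.
Proof.
move=> T0; rewrite /psi fineK// ge0_fin_numE.
  by apply: le_lt_trans (psi_series_le T0) _; rewrite ltry.
by apply: nneseries_ge0 => n _ _; rewrite lee_fin primitive_step_ge0.
Qed.

Lemma integral_star_lacunary T : 0 < T ->
  (\int[leb]_(s in `]0%R, T[) star lacunary s = (psi T)%:E)%E.
Proof. by move=> T0; rewrite (integral_star_steps jump_pointP T0) psiE// ltW. Qed.

Lemma psi_gt0 T : 0 < T -> 0 < psi T.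
Proof.
move=> T0; rewrite -lte_fin psiE ?ltW//.
apply: lt_le_trans (nneseries_lim_ge 1 _); last first.
  by move=> n _ _; rewrite lee_fin primitive_step_ge0 ?ltW.
rewrite big_nat1 lte_fin /primitive_step !mulr_gt0 ?invr_gt0 ?exprn_gt0//.
by rewrite lt_min T0 exprn_gt0.
Qed.

Lemma le_psi s t : 0 <= s -> s <= t -> psi s <= psi t.
Proof.
move=> s0 st; rewrite -lee_fin !psiE ?(le_trans s0)//.
apply: lee_nneseries => n; first by rewrite lee_fin primitive_step_ge0.
move=> _; rewrite lee_fin ler_wpM2l ?divr_ge0 ?exprn_ge0//.
by rewrite le_min !ge_min st lexx orbT.
Qed.

Lemma psi_le T : 0 <= T -> psi T <= 2 * T.
Proof. by move=> T0; rewrite -lee_fin psiE// psi_series_le. Qed.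

(** Each summand is a multiple of [T -> min(T, t_n)]. *)
Lemma psi_concave a s t : 0 <= a <= 1 -> 0 < s -> 0 < t ->
  a * psi s + (1 - a) * psi t <= psi (a * s + (1 - a) * t).
Proof.
move=> /andP[a0 a1] s0 t0; have b0 : 0 <= 1 - a by rewrite subr_ge0.
rewrite -lee_fin EFinD !EFinM !psiE ?(ltW s0) ?(ltW t0)//; last first.
  by apply: addr_ge0; apply: mulr_ge0 => //; exact: ltW.
rewrite -!nneseriesZl//; try by move=> n _; rewrite lee_fin primitive_step_ge0// ltW.
rewrite -nneseriesD; try by move=> n _ _; rewrite mule_ge0 ?lee_fin ?primitive_step_ge0// ltW.
apply: lee_nneseries => n.
  by move=> _; rewrite adde_ge0 ?mule_ge0 ?lee_fin ?primitive_step_ge0// ltW.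
move=> _; rewrite -!EFinM -EFinD lee_fin /primitive_step.
set p := _ / _; have p0 : 0 <= p by rewrite divr_ge0 ?exprn_ge0.
rewrite !(mulrCA _ p) -mulrDr ler_wpM2l// le_min; apply/andP; split.
  by apply: lerD; rewrite ler_wpM2l// ge_min lexx.
rewrite [leRHS](_ : _ = a * jump_point n + (1 - a) * jump_point n); last by ring.
by apply: lerD; rewrite ler_wpM2l// ge_min lexx orbT.
Qed.

Lemma psi_weight : Marcinkiewicz_weight psi.
Proof.
split.
- exact: psi_gt0.
- by move=> s t s0; apply: le_psi; exact: ltW.
- exact: psi_concave.
- apply/cvgrPdist_le => e e0; near=> t.
  have t0 : 0 < t by near: t; exact: nbhs_right_gt.
  rewrite sub0r normrN gtr0_norm ?psi_gt0//; apply: (le_trans (psi_le (ltW t0))).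
  rewrite mulrC -ler_pdivlMr//; near: t; apply: nbhs_right_le; exact: divr_gt0.
Unshelve. all: by end_near. Qed.

(** Piecewise comparison of primitives, since [t_n <= s_n]. *)
Lemma integral_star_spread_le T : 0 < T ->
  (\int[leb]_(s in `]0%R, T[) star spread s <= (psi T)%:E)%E.
Proof.
move=> T0; rewrite (integral_star_steps spread_pointP T0) (psiE (ltW T0))//.
apply: lee_nneseries => [n _ _|n _].
  rewrite lee_fin /primitive_step mulr_ge0 ?divr_ge0 ?exprn_ge0//.
  by rewrite le_min (ltW T0) exprn_ge0.
rewrite lee_fin /primitive_step -!mulrA ler_pM2l ?exprn_gt0//.
have fg : jump_point n <= spread_point n by rewrite ler_eXn2l ?ltr1n//; lia.
have gV : (spread_point n)^-1 <= (jump_point n)^-1 by rewrite lef_pV2 ?posrE ?jump_point_gt0 ?spread_point_gt0.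
have [Tf|fT] := leP T (jump_point n).
  by rewrite min_l ?(le_trans Tf)// ler_wpM2r// ltW.
rewrite mulVf ?gt_eqF ?jump_point_gt0//.
apply: (@le_trans _ _ ((spread_point n)^-1 * spread_point n)).
  by rewrite ler_wpM2l ?invr_ge0 ?(ltW (spread_point_gt0 n))// ge_min lexx orbT.
by rewrite mulVf// gt_eqF// spread_point_gt0.
Qed.

(** The first [n + 1] pieces contribute [2^(n+1) - 1], the later ones at most [2^n]. *)
Lemma psi_jump_point n : psi (jump_point n) <= 3 * 2 ^+ n.
Proof.
have t0 := ltW (jump_point_gt0 n).
rewrite -lee_fin psiE// (nneseries_split 0 n.+1); last first.
  by move=> m _; rewrite lee_fin primitive_step_ge0.
rewrite (_ : 3 * 2 ^+ n = 2 * 2 ^+ n + 2 ^+ n :> R); last by ring.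
rewrite EFinD add0n; apply: leeD.
  rewrite sumEFin lee_fin.
  apply: (@le_trans _ _ (\sum_(0 <= m < n.+1) 2 ^+ m)).
    apply: ler_sum => m _; rewrite /primitive_step -mulrA ler_piMr ?exprn_ge0//.
    by rewrite ler_pdivrMl ?jump_point_gt0// mulr1 ge_min lexx orbT.
  rewrite big_mkord; have := subrX1 (2 : R) n.+1; rewrite (_ : 2 - 1 = 1)%R; last by ring.
  by rewrite mul1r => <-; rewrite exprS; lra.
apply: (@le_trans _ _ (\sum_(n.+1 <= m <oo) (2 ^+ n / 2 ^+ m.+1)%:E)%E).
  rewrite -nneseries_addn; last by move=> m; rewrite lee_fin primitive_step_ge0.
  rewrite -[leRHS]nneseries_addn; last by move=> m; rewrite lee_fin divr_ge0 ?exprn_ge0.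
  apply: lee_nneseries => [m _ _|m _]; first by rewrite lee_fin primitive_step_ge0.
  rewrite lee_fin /primitive_step.
  apply: (@le_trans _ _ (probe n / 2 ^+ n / 2 ^+ (m + n.+1).+1 * jump_point n)).
    apply: ler_pM; rewrite ?divr_ge0 ?exprn_ge0//.
    - by rewrite le_min t0 exprn_ge0.
    - by apply: jump_coef_tail; rewrite ltn_addl.
    - by rewrite ge_min lexx.
  rewrite /probe mulrAC ler_wpM2r ?invr_ge0 ?exprn_ge0//.
  rewrite mulrAC mulVf ?gt_eqF ?jump_point_gt0// mul1r.
  rewrite (@le_trans _ _ 1)// ?exprn_ege1 ?ler1n//.
  by rewrite invf_le1 ?exprn_gt0// exprn_ege1 ?ler1n.
rewrite -nneseries_addn; last by move=> m; rewrite lee_fin divr_ge0 ?exprn_ge0.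
apply: nneseries_le_geometric => [|m]; first exact: exprn_ge0.
rewrite divr_ge0 ?exprn_ge0//= ler_wpM2l ?exprn_ge0//.
by rewrite lef_pV2 ?posrE ?exprn_gt0// ler_eXn2l ?ltr1n// ltnS leq_addr.
Qed.

End weights.

(** * Domination and flatness *)

Section gauge.
Context {R : realType}.
Implicit Types (X Y Z phi psi : R -> R) (A B a c M k : R).
Local Notation mu := (@completed_lebesgue_measure R).
Local Notation leb := (@lebesgue_measure R).
Local Notation f := (@lacunary R).
Local Notation g := (@spread R).
Local Notation probe := (@probe R).

Lemma lacunary_measurable : lebesgue_measurable f.
Proof. exact: (steps_measurable jump_pointP). Qed.
Lemma spread_measurable : lebesgue_measurable g.
Proof. exact: (steps_measurable spread_pointP). Qed.
Lemma lacunary_nonneg : nonneg_on_halfline f.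
Proof. by move=> x _; exact: (steps_ge0 jump_pointP). Qed.
Lemma spread_nonneg : nonneg_on_halfline g.
Proof. by move=> x _; exact: (steps_ge0 spread_pointP). Qed.
Lemma finite_star_lacunary : finite_star f.
Proof. exact: (finite_star_steps jump_pointP). Qed.
Lemma finite_star_spread : finite_star g.
Proof. exact: (finite_star_steps spread_pointP). Qed.

Lemma star_lacunary x : 0 < x -> star f x = (f x)%:E.
Proof. exact: (star_steps jump_pointP). Qed.
Lemma star_spread x : 0 < x -> star g x = (g x)%:E.
Proof. exact: (star_steps spread_pointP). Qed.

Lemma integral_excess_ge0 c X : nonneg_on_halfline X -> (0 <= integral_of (excess c) X)%E.
Proof. by move=> X0; apply: integral_of_ge0 => // x _; exact: excess_ge0. Qed.

Lemma le_excess c c' x : c' <= c -> excess c x <= excess c' x.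
Proof. by move=> cc; rewrite /excess ge_max !le_max lexx orbT andbT lerB. Qed.

Lemma measurable_excess c : measurable_fun [set: R] (excess c).
Proof. by apply: measurable_maxr => //; apply: measurable_funD. Qed.
Lemma measurable_band c M : measurable_fun [set: R] (band c M).
Proof.
by apply: measurable_maxr => //; apply: measurable_funD => //; apply: measurable_minr.
Qed.

Lemma integral_excess_antitone c c' X : lebesgue_measurable X ->
  c' <= c -> (integral_of (excess c) X <= integral_of (excess c') X)%E.
Proof.
move=> mX cc; apply: le_integral_of => //; try exact: measurable_excess.
by move=> x _; rewrite excess_ge0 le_excess.
Qed.

(** [f] is at most [c] after [t_n], so [G_c f] is bounded by [psi t_n]. *)
Lemma integral_excess_lacunary n c : probe n / 2 ^+ n <= c ->
  (integral_of (excess c) f <= (3 * 2 ^+ n)%:E)%E.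
Proof.
move=> nc; have t0 := @jump_point_gt0 R n.
apply: le_trans (integral_excess_antitone lacunary_measurable nc) _.
have fn := @lacunary_tail R n _ (lexx _).
apply: le_trans (integral_excess_antitone lacunary_measurable fn) _.
apply: (@le_trans _ _ (psi (@jump_point R n))%:E); last by rewrite lee_fin psi_jump_point.
rewrite -integral_star_lacunary//.
rewrite (integral_star_eq lacunary_measurable lacunary_nonneg finite_star_lacunary t0) star_lacunary//=.
by rewrite leeDr// lee_fin mulr_ge0 ?(ltW t0)//; exact: (steps_ge0 jump_pointP).
Qed.

(** A reformulation of [\int_0^t X^* <= A \int_0^t f] that is additive and positively
homogeneous in [(A, X)]; see [dominatedP]. *)
Definition dominated A X := forall c, 0 < c ->
  (integral_of (excess (A * c)) X <= A%:E * integral_of (excess c) f)%E.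

(** The seminorm [sup_k limsup_n 2^(-n) W_(a_n / k, k a_n) X], expressed through its upper
bounds [A / 4]; the factor [4] fixes the separation between [f] and [g]. *)
Definition flat A X := forall k, 0 < k -> \forall n \near \oo,
  (integral_of (band (probe n / k) (k * probe n)) X <= (A / 4 * 2 ^+ n)%:E)%E.

Lemma dominated_upper A B X : lebesgue_measurable X -> 0 < A -> A <= B ->
  dominated A X -> dominated B X.
Proof.
move=> mX A0 AB dX c c0; have B0 := lt_le_trans A0 AB.
have := dX _ (mulr_gt0 (divr_gt0 B0 A0) c0).
rewrite mulrA (mulrC A) divfK ?gt_eqF// => /le_trans; apply.
apply: lee_pmul; rewrite ?lee_fin ?(ltW A0)//; first exact/integral_excess_ge0/lacunary_nonneg.
apply: integral_excess_antitone; first exact: lacunary_measurable.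
by rewrite ler_peMl ?(ltW c0)// ler_pdivlMr// mul1r.
Qed.

Lemma flat_upper A B X : A <= B -> flat A X -> flat B X.
Proof.
move=> AB fX k k0; near=> n.
apply: (@le_trans _ _ (A / 4 * 2 ^+ n)%:E); first by near: n; exact: fX.
by rewrite lee_fin ler_wpM2r ?exprn_ge0// ler_wpM2r// invr_ge0.
Unshelve. all: by end_near. Qed.

Lemma geometric_unbounded (C : R) : \forall n \near \oo, C <= 2 ^+ n.
Proof.
near=> n; apply: (@le_trans _ _ n%:R); first by near: n; exact: nbhs_infty_ger.
by rewrite -natrX ler_nat ltnW// ltn_expl.
Unshelve. all: by end_near. Qed.

(** For fixed [c] and [A] the level [a_n c / A] eventually lies above all later pieces of [f]. *)
Lemma excess_eventually A X c : 0 < A -> 0 < c -> lebesgue_measurable X ->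
  dominated A X ->
  \forall n \near \oo, (integral_of (excess (probe n * c)) X <= (A * (3 * 2 ^+ n))%:E)%E.
Proof.
move=> A0 c0 mX dX; near=> n.
have := dX _ (divr_gt0 (mulr_gt0 (@probe_gt0 R n) c0) A0).
rewrite mulrC divfK ?gt_eqF// => /le_trans; apply.
rewrite EFinM lee_wpmul2l ?lee_fin ?(ltW A0)//.
apply: integral_excess_lacunary; rewrite -mulrA ler_pM2l ?probe_gt0//.
rewrite -[leRHS]invrK lef_pV2 ?posrE ?exprn_gt0 ?invr_gt0 ?divr_gt0//.
by near: n; exact: geometric_unbounded.
Unshelve. all: by end_near. Qed.

(** With [G_c f <= 3 2^n], the constant [12 A] is [4] times [3 A]. *)
Lemma flat_of_dominated A X : 0 < A -> lebesgue_measurable X ->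
  dominated A X -> flat (12 * A) X.
Proof.
move=> A0 mX dX k k0; near=> n.
apply: (@le_trans _ _ (integral_of (excess (probe n * k^-1)) X)).
  apply: le_integral_of => //; [exact: measurable_band|exact: measurable_excess|].
  by move=> x _; rewrite band_ge0 band_le_excess.
apply: (@le_trans _ _ (A * (3 * 2 ^+ n))%:E).
  by near: n; apply: excess_eventually => //; rewrite invr_gt0.
by rewrite lee_fin; lra.
Unshelve. all: by end_near. Qed.

Definition gauge A X := dominated A X /\ flat A X.

Lemma gauge_upper A B X : lebesgue_measurable X -> 0 < A -> A <= B ->
  gauge A X -> gauge B X.
Proof.
by move=> mX A0 AB [dX fX]; split; [exact: dominated_upper dX|exact: flat_upper fX].
Qed.

Lemma gauge_of_dominated A X : 0 < A -> lebesgue_measurable X ->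
  dominated A X -> gauge (12 * A) X.
Proof.
move=> A0 mX dX; split; last exact: flat_of_dominated.
by apply: dominated_upper dX => //; lra.
Qed.

Lemma integral_ofD_le phi phi1 phi2 X Y Z :
  measurable_fun [set: R] phi -> measurable_fun [set: R] phi1 ->
  measurable_fun [set: R] phi2 ->
  (forall x, 0 <= phi1 x) -> (forall x, 0 <= phi2 x) ->
  lebesgue_measurable X -> lebesgue_measurable Y -> lebesgue_measurable Z ->
  (forall x, 0 < x -> 0 <= phi (Z x) <= phi1 (X x) + phi2 (Y x)) ->
  (integral_of phi Z <= integral_of phi1 X + integral_of phi2 Y)%E.
Proof.
move=> mp mp1 mp2 p1 p2 mX mY mZ h.
have mD := @measurable_halfline R.
have m1 := measurable_comp_halfline mp1 mX.
have m2 := measurable_comp_halfline mp2 mY.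
have mZ' := measurable_comp_halfline mp mZ.
apply: (@le_trans _ _
  (\int[mu]_(x in `]0%R, +oo[) ((phi1 (X x))%:E + (phi2 (Y x))%:E))%E).
  apply: ge0_le_integral.
  - exact: mD.
  - move=> x; rewrite /= in_itv/= andbT => x0; rewrite lee_fin.
    by case/andP: (h _ x0).
  - exact: mZ'.
  - exact: (emeasurable_funD m1 m2).
  - move=> x; rewrite /= in_itv/= andbT => x0; rewrite lee_fin.
    by case/andP: (h _ x0).
have p1' x : (`]0, +oo[%classic : set (lebesgueType R)) x -> (0 <= (phi1 (X x))%:E)%E.
  by move=> _; rewrite lee_fin.
have p2' x : (`]0, +oo[%classic : set (lebesgueType R)) x -> (0 <= (phi2 (Y x))%:E)%E.
  by move=> _; rewrite lee_fin.
by rewrite (ge0_integralD mu mD p1' m1 p2' m2).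
Qed.

Lemma dominatedD A B X Y Z : lebesgue_measurable X -> lebesgue_measurable Y ->
  lebesgue_measurable Z -> (forall x, 0 < x -> Z x <= X x + Y x) ->
  0 < A -> 0 < B -> dominated A X -> dominated B Y -> dominated (A + B) Z.
Proof.
move=> mX mY mZ ZXY A0 B0 dX dY c c0.
apply: (@le_trans _ _ (integral_of (excess (A * c)) X + integral_of (excess (B * c)) Y)%E).
  apply: integral_ofD_le => //; try exact: measurable_excess; try exact: excess_ge0.
  move=> x x0; rewrite excess_ge0/= {1}/excess ge_max addr_ge0 ?excess_ge0// andbT.
  have h (d y : R) : y - d <= excess d y by rewrite /excess le_max lexx.
  have := h (A * c) (X x); have := h (B * c) (Y x); have := ZXY _ x0; lra.
rewrite EFinD (@ge0_muleDl _ _ A%:E B%:E) ?lee_fin ?(ltW A0) ?(ltW B0)//.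
by apply: leeD; [exact: dX|exact: dY].
Qed.

(** If one of the summands exceeds [M], its own window already has the full height
[M - c / 2]. *)
Lemma band_subadd (c M x y z : R) : 0 <= x -> 0 <= y -> 0 <= c -> z <= x + y ->
  band c M z <= band (c / 2) M x + band (c / 2) M y.
Proof.
move=> x0 y0 c0 zxy.
have h (u : R) : Num.min u M - c / 2 <= band (c / 2) M u by rewrite /band le_max lexx.
have hx := band_ge0 (c / 2) M x; have hy := band_ge0 (c / 2) M y.
rewrite {1}/band ge_max addr_ge0// andbT.
have [xM|Mx] := leP x M; last first.
  have := h x; rewrite (min_r (ltW Mx)).
  have : Num.min z M <= M by rewrite ge_min lexx orbT.
  lra.
have [yM|My] := leP y M; last first.
  have := h y; rewrite (min_r (ltW My)).
  have : Num.min z M <= M by rewrite ge_min lexx orbT.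
  lra.
have := h x; have := h y; rewrite (min_l xM) (min_l yM).
have : Num.min z M <= z by rewrite ge_min lexx.
lra.
Qed.

(** Halving the lower level is absorbed by replacing [k] with [2 k]. *)
Lemma flatD A B X Y Z : lebesgue_measurable X -> lebesgue_measurable Y ->
  lebesgue_measurable Z -> nonneg_on_halfline X -> nonneg_on_halfline Y ->
  (forall x, 0 < x -> Z x <= X x + Y x) ->
  flat A X -> flat B Y -> flat (A + B) Z.
Proof.
move=> mX mY mZ X0 Y0 ZXY fX fY k k0; have k20 : 0 < 2 * k by rewrite mulr_gt0.
near=> n.
have hX : (integral_of (band (probe n / (2 * k)) (2 * k * probe n)) X <= (A / 4 * 2 ^+ n)%:E)%E.
  by near: n; exact: fX.
have hY : (integral_of (band (probe n / (2 * k)) (2 * k * probe n)) Y <= (B / 4 * 2 ^+ n)%:E)%E.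
  by near: n; exact: fY.
rewrite !mulrDl EFinD; apply: le_trans (leeD hX hY).
apply: integral_ofD_le => //; try exact: measurable_band; try by move=> x; exact: band_ge0.
move=> x x0; rewrite band_ge0/=.
have hn := @probe_gt0 R n.
have E : probe n / (2 * k) = probe n / k / 2.
  by rewrite invfM [2^-1 * _]mulrC mulrA.
have kh : k * probe n <= 2 * k * probe n.
  by rewrite ler_pM2r// ler_peMl ?(ltW k0)// ler1n.
apply: (le_trans (band_subadd (k * probe n) (X0 _ x0) (Y0 _ x0) _ (ZXY _ x0))).
  by rewrite divr_ge0 ?ltW.
by rewrite E; apply: lerD; apply: le_band.
Unshelve. all: by end_near. Qed.

Lemma gaugeD A B X Y Z : lebesgue_measurable X -> lebesgue_measurable Y ->
  lebesgue_measurable Z -> nonneg_on_halfline X -> nonneg_on_halfline Y ->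
  (forall x, 0 < x -> Z x <= X x + Y x) -> 0 < A -> 0 < B ->
  gauge A X -> gauge B Y -> gauge (A + B) Z.
Proof.
move=> mX mY mZ X0 Y0 ZXY A0 B0 [dX fX] [dY fY]; split.
  exact: dominatedD dX dY.
exact: flatD fX fY.
Qed.

Lemma integral_ofZ_le phi psi a X Z :
  measurable_fun [set: R] phi -> measurable_fun [set: R] psi ->
  (forall x, 0 <= psi x) -> 0 <= a ->
  lebesgue_measurable X -> lebesgue_measurable Z ->
  (forall x, 0 < x -> 0 <= phi (Z x) <= a * psi (X x)) ->
  (integral_of phi Z <= a%:E * integral_of psi X)%E.
Proof.
move=> mp mp1 p1 a0 mX mZ h; have mD := @measurable_halfline R.
have mpsi := measurable_comp_halfline mp1 mX.
have mphi := measurable_comp_halfline mp mZ.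
apply: (@le_trans _ _ (\int[mu]_(x in `]0%R, +oo[) (a%:E * (psi (X x))%:E))%E).
  apply: ge0_le_integral.
  - exact: mD.
  - by move=> x; rewrite /= in_itv/= andbT => x0; rewrite lee_fin; case/andP: (h _ x0).
  - exact: mphi.
  - exact: (measurable_funeM a%:E mpsi).
  - by move=> x; rewrite /= in_itv/= andbT => x0; rewrite lee_fin; case/andP: (h _ x0).
have p1' x : (`]0, +oo[%classic : set (lebesgueType R)) x -> (0 <= (psi (X x))%:E)%E.
  by move=> _; rewrite lee_fin.
by rewrite (ge0_integralZl mu mD mpsi p1').
Qed.

Lemma excessZ a c x : 0 <= a -> excess (a * c) (a * x) = a * excess c x.
Proof. by move=> a0; rewrite /excess -mulrBr maxr_pMr// mulr0. Qed.
Lemma bandZ a c M x : 0 <= a -> band (a * c) (a * M) (a * x) = a * band c M x.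
Proof. by move=> a0; rewrite /band -minr_pMr// -mulrBr maxr_pMr// mulr0. Qed.

(** Rescaling moves the window by the factor [a], which is absorbed by enlarging [k]. *)
Lemma gaugeZ a A X Z : lebesgue_measurable X -> lebesgue_measurable Z ->
  0 < a -> (forall x, 0 < x -> Z x = a * X x) -> gauge A X -> gauge (a * A) Z.
Proof.
move=> mX mZ a0 ZX [dX fX]; split.
  move=> c c0; rewrite EFinM -muleA.
  apply: le_trans (lee_wpmul2l _ (dX _ c0)); last by rewrite lee_fin ltW.
  apply: integral_ofZ_le => //; try exact: measurable_excess; try exact: ltW.
    by move=> x; exact: excess_ge0.
  by move=> x x0; rewrite excess_ge0/= ZX// -mulrA excessZ// ltW.
move=> k k0; set k' := k * (a + a^-1).
have aV0 : 0 < a^-1 by rewrite invr_gt0.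
have s0 : 0 < a + a^-1 by rewrite addr_gt0.
have k'0 : 0 < k' by rewrite mulr_gt0.
near=> n; have hn := @probe_gt0 R n.
apply: (@le_trans _ _ (a%:E * integral_of (band (probe n / k') (k' * probe n)) X)%E); last first.
  rewrite (_ : a * A / 4 * 2 ^+ n = a * (A / 4 * 2 ^+ n)); last by rewrite !mulrA.
  rewrite EFinM lee_wpmul2l ?lee_fin ?(ltW a0)//.
  by near: n; exact: fX.
apply: integral_ofZ_le => //; try exact: measurable_band; try exact: ltW.
  by move=> x; exact: band_ge0.
move=> x x0; rewrite band_ge0/= ZX// -bandZ ?(ltW a0)//; apply: le_band.
  have -> : a * (probe n / k') = probe n / k * (a / (a + a^-1)).
    by rewrite /k' invfM !mulrA; congr (_ * _); rewrite [RHS]mulrC mulrA.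
  rewrite ler_piMr//; first by rewrite divr_ge0 ?ltW.
  by rewrite ler_pdivrMr// mul1r lerDl ltW.
have -> : a * (k' * probe n) = (a * (a + a^-1)) * (k * probe n) by rewrite /k'; ring.
rewrite ler_peMl ?mulr_ge0 ?(ltW k0) ?(ltW hn)//.
by rewrite mulrDr divff ?gt_eqF// lerDr mulr_ge0// ltW.
Unshelve. all: by end_near. Qed.

Lemma dominated_le_star A X Y : lebesgue_measurable X -> nonneg_on_halfline X ->
  lebesgue_measurable Y -> nonneg_on_halfline Y -> finite_star Y -> 0 < A ->
  (forall t, 0 < t -> (star X t <= star Y t)%E) -> dominated A Y -> dominated A X.
Proof.
move=> mX X0 mY Y0 fY A0 XY dY c c0; apply: le_trans (dY _ c0).
by apply: integral_of_le_star => //; apply: height_excess; rewrite mulr_ge0// ltW.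
Qed.

Lemma gauge_le_star A X Y : lebesgue_measurable X -> nonneg_on_halfline X ->
  lebesgue_measurable Y -> nonneg_on_halfline Y -> finite_star Y -> 0 < A ->
  (forall t, 0 < t -> (star X t <= star Y t)%E) -> gauge A Y -> gauge A X.
Proof.
move=> mX X0 mY Y0 fY A0 XY [dY flY]; split; first exact: dominated_le_star dY.
move=> k k0; near=> n.
apply: (@le_trans _ _ (integral_of (band (probe n / k) (k * probe n)) Y)); last first.
  by near: n; exact: flY.
apply: integral_of_le_star => //; apply: height_band.
by rewrite divr_ge0 ?ltW// probe_gt0.
Unshelve. all: by end_near. Qed.

(** Strictly larger constants are needed: [q] exceeds one and the error term is positive
before the limits in [q] and [k']. *)
Lemma gauge_log A B X Y : lebesgue_measurable X -> nonneg_on_halfline X ->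
  lebesgue_measurable Y -> nonneg_on_halfline Y -> 0 < A -> A < B ->
  (forall r, 0 < r ->
    (integral_of (log_excess r) X <= integral_of (log_excess r) Y)%E) ->
  gauge A Y -> gauge B X.
Proof.
move=> mX X0 mY Y0 A0 AB XY [dY fY]; split.
  apply: (@dominated_upper A) => //; first exact: ltW.
  move=> c c0; apply: le_trans (dY _ c0).
  by apply: excess_le_of_log => //; exact: mulr_gt0.
move=> k k0.
(* [q] turns [A] into the midpoint of [A] and [B]; the factor [L] of [k'] makes the
   error term fit into the other half of the room. Enlarging [k] to [k1 >= 1] ensures
   that the window is not empty. *)
pose k1 := 1 + k; pose q := (A + B) / (2 * A).
pose L := 1 + 24 * A / (B - A); pose k' := q * k1 * L.
have BA : 0 < B - A by rewrite subr_gt0.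
have q1 : 1 < q by rewrite /q ltr_pdivlMr ?mulr_gt0//; lra.
have q0 : 0 < q by lra.
have k1_ge1 : 1 <= k1 by rewrite /k1; lra.
have k10 : 0 < k1 by lra.
have qk0 : 0 < q * k1 by rewrite mulr_gt0.
have L1 : 1 <= L by rewrite /L lerDl divr_ge0 ?mulr_ge0 ?ltW.
have L0 : 0 < L by lra.
have k'0 : 0 < k' by rewrite mulr_gt0.
have qk' : q * k1 <= k' by rewrite /k' ler_peMr// ltW.
have k1k' : k1 <= k' by rewrite (le_trans _ qk')// ler_peMl ?ltW.
near=> n; have hn := @probe_gt0 R n.
have hY : (integral_of (band (probe n / k') (k' * probe n)) Y <= (A / 4 * 2 ^+ n)%:E)%E.
  by near: n; exact: fY.
have eY : (integral_of (excess (probe n * k')) Y <= (A * (3 * 2 ^+ n))%:E)%E.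
  by near: n; exact: excess_eventually.
apply: (@le_trans _ _ (integral_of (band (probe n / k1) (k1 * probe n)) X)).
  apply: le_integral_of => //; try exact: measurable_band.
  move=> x _; rewrite band_ge0/=; apply: le_band.
    by rewrite ler_pM2l// lef_pV2 ?posrE// /k1; lra.
  by rewrite ler_pM2r// /k1; lra.
have hk1 : probe n / k1 <= k1 * probe n.
  by rewrite mulrC ler_pM2r// (le_trans _ k1_ge1)// invf_le1.
have hk' : q * (k1 * probe n) <= k' * probe n by rewrite mulrA ler_pM2r.
apply: (le_trans (band_le_of_log mX X0 mY Y0 XY (divr_gt0 hn k10) q1 hk1 hk')).
have -> : q * (k1 * probe n) / (k' * probe n) = L^-1.
  by rewrite /k'; field; rewrite !gt_eqF.
apply: (@le_trans _ _ (q%:E * (A / 4 * 2 ^+ n)%:E + L^-1%:E * (A * (3 * 2 ^+ n))%:E)%E).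
  apply: leeD; apply: lee_wpmul2l; rewrite ?lee_fin ?invr_ge0 ?(ltW q0) ?(ltW L0)//.
    apply: le_trans hY; apply: le_integral_of => //; try exact: measurable_band.
    move=> x _; rewrite band_ge0/=; apply: le_band => //.
    by rewrite ler_pM2l// lef_pV2 ?posrE.
  by rewrite mulrC.
rewrite -!EFinM -EFinD lee_fin.
have qA : q * A = (A + B) / 2 by rewrite /q; field; rewrite gt_eqF.
have LA : L^-1 * (24 * A) <= B - A.
  have LE : L * (B - A) = B - A + 24 * A by rewrite /L; field; rewrite gt_eqF.
  by rewrite ler_pdivrMl// LE; lra.
have w0 : 0 <= 2 ^+ n :> R by rewrite exprn_ge0.
rewrite (_ : q * (A / 4 * 2 ^+ n) + L^-1 * (A * (3 * 2 ^+ n)) =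
  (q * A / 4 + L^-1 * (24 * A) / 8) * 2 ^+ n); last by field; rewrite gt_eqF.
rewrite ler_wpM2r// qA; lra.
Unshelve. all: by end_near. Qed.

(** For large [n] the window [[a_n / k, k a_n]] contains no value of [f], so [f] contributes
at most [k a_n t_n = k]. *)
Lemma gauge_lacunary : gauge 1 f.
Proof.
split; first by move=> c _; rewrite mul1r mul1e.
move=> k k0; near=> n; have hn := @probe_gt0 R n.
apply: (@le_trans _ _ k%:E); last first.
  by rewrite lee_fin mul1r mulrC ler_pdivlMr//; near: n; exact: geometric_unbounded.
have kE : k * probe n * jump_point n = k by rewrite /probe mulfVK ?gt_eqF ?jump_point_gt0.
rewrite -[X in (_ <= X%:E)%E]kE; have fp := @jump_point_gt0 R n.
apply: integral_band_le => //; rewrite ?jump_point_gt0//.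
- exact: lacunary_measurable.
- exact: lacunary_nonneg.
- exact: finite_star_lacunary.
- by rewrite divr_ge0// ltW.
- by rewrite mulr_ge0// ltW.
- rewrite star_lacunary// lee_fin; apply: (le_trans (lacunary_tail (lexx _))).
  rewrite ler_pM2l// lef_pV2 ?posrE ?exprn_gt0//.
  by near: n; exact: geometric_unbounded.
Unshelve. all: by end_near. Qed.

Lemma dominated_spread : dominated 1 g.
Proof.
move=> c c0; apply: excess_le_of_submajorized => //.
- exact: spread_measurable.
- exact: spread_nonneg.
- exact: finite_star_spread.
- exact: lacunary_measurable.
- exact: lacunary_nonneg.
- exact: finite_star_lacunary.
- exact: ltW.
- move=> t t0; rewrite [leRHS]mul1e [leRHS]integral_star_lacunary//.
  exact: integral_star_spread_le.
Qed.

(** [g >= a_n] on [(0, s_n)], an interval of measure [2^n / a_n]. *)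
Lemma gauge_spread_ge2 A : gauge A g -> 2 <= A.
Proof.
move=> [_ /(_ 2)]; rewrite ltr0n => /(_ isT) [n _ /(_ n (leqnn n))/=].
have hn := @probe_gt0 R n; have gp := @spread_point_gt0 R n.
set hb := height_band (2 * probe n) (divr_ge0 (ltW hn) (ltW (ltr0n R 2))).
rewrite -integral_of_star//; [|exact: spread_measurable|exact: spread_nonneg|exact: finite_star_spread].
move=> h.
have : ((probe n / 2 * spread_point n)%:E <= (A / 4 * 2 ^+ n)%:E)%E.
  apply: le_trans h.
  apply: (@le_trans _ _ (\int[leb]_(s in `]0%R, spread_point n[) (band (probe n / 2) (2 * probe n) (fine (star g s)))%:E)%E).
    apply: (@le_trans _ _ (\int[leb]_(s in `]0%R, spread_point n[) (cst (probe n / 2)%:E s))%E).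
      rewrite integral_cst//= lebesgue_measure_itv/= lte_fin gp oppr0 adde0 -EFinM//.
    apply: ge0_le_integral => //.
    - by move=> s _; rewrite lee_fin divr_ge0// ltW.
    - by apply: measurable_height_star => //; exact: finite_star_spread.
    - move=> s /=; rewrite in_itv/= => /andP[s0 sg]; rewrite lee_fin star_spread//=.
      have := steps_ge spread_pointP sg; rewrite spread_coef => hg.
      have hm : probe n <= Num.min (g s) (2 * probe n) by rewrite le_min hg; lra.
      by rewrite /band le_max; apply/orP; left; lra.
  apply: ge0_subset_integral => //.
  - by apply: measurable_height_star => //; exact: finite_star_spread.
  - by move=> s _; apply: height_star_ge0.
  - by move=> s /=; rewrite !in_itv/= andbT => /andP[].
have -> : probe n / 2 * spread_point n = 2 ^+ n / 2.
  by rewrite -spread_coef mulrAC divfK ?gt_eqF.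
rewrite lee_fin [leRHS]mulrC ler_pM2l ?exprn_gt0// => ?; lra.
Qed.

(** On a set of measure [T] the windows contribute [k a_n T], which tends to zero. *)
Lemma gauge_bounded_support X T : lebesgue_measurable X -> nonneg_on_halfline X -> 0 < T ->
  (forall x, 0 < x -> X x <= g x) -> (forall x, T < x -> X x = 0) -> gauge 1 X.
Proof.
move=> mX X0 T0 Xg XT.
have XgS t : 0 < t -> (star X t <= star g t)%E.
  by move=> t0; apply: le_star; apply: aeW => x; exact: Xg.
split.
  apply: dominated_le_star dominated_spread => //; [exact: spread_measurable|exact: spread_nonneg|exact: finite_star_spread].
move=> k k0; near=> n; have hn := @probe_gt0 R n.
apply: (@le_trans _ _ (k * T)%:E); last first.
  by rewrite lee_fin mul1r [leRHS]mulrC ler_pdivlMr//; near: n; exact: geometric_unbounded.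
have h1 : probe n <= 1.
  by rewrite invf_le1 ?jump_point_gt0// exprn_ege1// ler1n.
apply: (@le_trans _ _ (k * probe n * T)%:E); last first.
  by rewrite lee_fin ler_wpM2r ?(ltW T0)// ler_piMr// ltW.
apply: integral_band_le => //.
- by move=> t t0; apply: le_lt_trans (XgS _ t0) (finite_star_spread t0).
- by rewrite divr_ge0 ?ltW.
- by rewrite mulr_ge0 ?ltW.
- apply: star_le; first by rewrite divr_ge0 ?ltW.
  apply: (@le_trans _ _ (leb `]0, T]%classic)).
    apply: le_outer_measure => y [y0 hy]; rewrite /= in_itv/= y0/=.
    rewrite leNgt; apply/negP => /XT Xy; move: hy.
    by rewrite Xy ltNge divr_ge0// ltW.
  by rewrite lebesgue_measure_itv/= lte_fin T0 oppr0 adde0.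
Unshelve. all: by end_near. Qed.

End gauge.

(** * The norm on nonnegative functions *)

(** Locked, as unification would otherwise unfold the infimum when comparing the norms
of two functions. *)
HB.lock Definition gauge_norm (R : realType) (X : R -> R) : R :=
  inf [set A | 0 < A /\ gauge A X].

Section gauge_norm.
Context {R : realType}.
Implicit Types (X Y Z : R -> R) (A B a c s t : R).
Local Notation mu := (@completed_lebesgue_measure R).
Local Notation leb := (@lebesgue_measure R).
Local Notation f := (@lacunary R).

Lemma markov_excess X c s : lebesgue_measurable X -> 0 < s ->
  (s%:E * level_measure X (c + s) <= integral_of (excess c) X)%E.
Proof.
move=> mX s0.
pose S : set (lebesgueType R) := [set x | 0 < x /\ c + s < X x].
have mS : measurable S by exact: measurable_level.
have SD : S `<=` (`]0, +oo[%classic : set (lebesgueType R)).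
  by move=> x [x0 _]; rewrite /= in_itv/= x0.
have me := measurable_comp_halfline (measurable_excess c) mX.
apply: (@le_trans _ _ (\int[mu]_(x in S) (excess c (X x))%:E)%E); last first.
  apply: ge0_subset_integral => //; first exact: measurable_halfline.
  by move=> x _; rewrite lee_fin excess_ge0.
rewrite (_ : s%:E * _ = \int[mu]_(x in S) (cst s%:E x))%E; last by rewrite integral_cst.
apply: ge0_le_integral.
- exact: mS.
- by move=> x _; rewrite lee_fin ltW.
- exact: measurable_cst.
- exact: (measurable_funS (@measurable_halfline R) SD me).
- by move=> x [x0 sX]; rewrite lee_fin /excess le_max; apply/orP; left; rewrite /cst; lra.
Qed.

Lemma finite_star_of_excess X c : lebesgue_measurable X ->
  0 <= c -> (integral_of (excess c) X < +oo)%E -> finite_star X.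
Proof.
move=> mX c0 If t t0; set I := integral_of _ _ in If.
have I0 : (0 <= I)%E.
  by apply: integral_ge0 => x _; rewrite lee_fin excess_ge0.
(* Markov's inequality at height [c + s] bounds the level measure by [I / s < t]. *)
pose s := fine I / t + 1.
have s0 : 0 < s by rewrite ltr_wpDl// divr_ge0 ?fine_ge0// ltW.
apply: (@le_lt_trans _ _ (c + s)%:E); last exact: ltry.
apply: star_le; first by rewrite addr_ge0// ltW.
have := markov_excess c mX s0; rewrite -/I -[I]fineK ?ge0_fin_numE//.
rewrite -lee_pdivlMl// => /le_trans; apply; rewrite -EFinM lee_fin ler_pdivrMl//.
by rewrite /s mulrDl mul1r divfK ?gt_eqF// lerDl ltW.
Qed.

Lemma integral_excess_lacunary_fin c : 0 < c -> (integral_of (excess c) f < +oo)%E.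
Proof.
move=> c0.
have [n _ /(_ n (leqnn n)) cn] := geometric_unbounded (c^-1).
apply: le_lt_trans (ltry (3 * 2 ^+ n)).
apply: integral_excess_lacunary; rewrite ler_pdivrMr ?exprn_gt0//.
apply: (@le_trans _ _ 1).
  by rewrite invf_le1 ?jump_point_gt0// exprn_ege1// ler1n.
by rewrite -ler_pdivrMl// mulr1.
Qed.

Lemma finite_star_of_dominated A X : lebesgue_measurable X -> 0 < A ->
  dominated A X -> finite_star X.
Proof.
move=> mX A0 dX; apply: (@finite_star_of_excess _ A) => //; first exact: ltW.
have := dX _ ltr01; rewrite mulr1 => /le_lt_trans; apply.
rewrite lte_mul_pinfty ?lee_fin ?(ltW A0)//; exact: integral_excess_lacunary_fin.
Qed.

Lemma star_lacunary_gt0 t : 0 < t -> (0 < star f t)%E.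
Proof. by move=> t0; rewrite star_lacunary// lte_fin; exact: (steps_gt0 jump_pointP). Qed.

(** Domination is the unit-ball condition of the Marcinkiewicz norm. *)
Lemma dominatedP A X : lebesgue_measurable X -> nonneg_on_halfline X -> 0 < A ->
  dominated A X <->
  forall t, 0 < t -> (\int[leb]_(s in `]0%R, t[) star X s <= (A * psi t)%:E)%E.
Proof.
move=> mX X0 A0; split => [dX t t0|XA].
  rewrite EFinM -integral_star_lacunary//.
  apply: submajorized_of_excess_le => //.
  - exact: finite_star_of_dominated dX.
  - exact: lacunary_measurable.
  - exact: lacunary_nonneg.
  - exact: finite_star_lacunary.
  - exact: star_lacunary_gt0.
have fX : finite_star X.
  move=> t t0; rewrite ltNge leye_eq; apply/negP => /eqP Xt.
  have := XA _ t0; rewrite leNgt => /negP; apply.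
  rewrite (@lt_le_trans _ _ +oo%E)// ?ltry//.
  apply: (@le_trans _ _ (\int[leb]_(s in `]0%R, t[) (cst +oo s))%E).
    by rewrite integral_cst//= lebesgue_measure_itv/= lte_fin t0 oppr0 adde0 gt0_mulye ?lte_fin.
  apply: ge0_le_integral => //.
    by move=> s _; exact: leey.
    exact: measurable_star.
  move=> s /=; rewrite in_itv/= => /andP[s0 st].
  by rewrite -Xt star_nonincreasing// ltW.
move=> c c0; apply: excess_le_of_submajorized => //.
- exact: lacunary_measurable.
- exact: lacunary_nonneg.
- exact: finite_star_lacunary.
- exact: ltW.
- by move=> t t0; rewrite integral_star_lacunary// -EFinM XA.
Qed.

(** The moduli of the elements of the space. *)
Record admissible X : Prop := {
  adm_measurable : lebesgue_measurable X ;
  adm_nonneg : nonneg_on_halfline X ;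
  adm_dominated : exists2 A, 0 < A & dominated A X
}.

Lemma adm_finite X : admissible X -> finite_star X.
Proof. by move=> [mX _ [A A0 dX]]; exact: finite_star_of_dominated dX. Qed.

Lemma gauge_norm_le A X : 0 < A -> gauge A X -> gauge_norm X <= A.
Proof.
by rewrite gauge_norm.unlock => A0 gA; apply: inf_lbound => //; exists 0 => B [B0 _]; exact: ltW.
Qed.

Lemma gauge_has_inf X : admissible X -> has_inf [set A | 0 < A /\ gauge A X].
Proof.
move=> [mX X0 [A A0 dX]]; split; last by exists 0 => B [B0 _]; exact: ltW.
exists (12 * A); split; first by rewrite mulr_gt0.
exact: gauge_of_dominated.
Qed.

Lemma gauge_norm_gauge X B : admissible X -> gauge_norm X < B -> gauge B X.
Proof.
rewrite gauge_norm.unlock => aX NB; have [mX X0 _] := aX.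
have e0 : 0 < B - inf [set A | 0 < A /\ gauge A X] by rewrite subr_gt0.
have [A [A0 gA]] := inf_adherent e0 (gauge_has_inf aX).
rewrite subrKC => AB; exact: gauge_upper (ltW AB) gA.
Qed.

Lemma gauge_norm_ge0 X : admissible X -> 0 <= gauge_norm X.
Proof.
rewrite gauge_norm.unlock => aX; apply: lb_le_inf; first by case: (gauge_has_inf aX).
by move=> A [A0 _]; exact: ltW.
Qed.

Lemma gauge_norm_ge c X : admissible X -> (forall A, 0 < A -> gauge A X -> c <= A) ->
  c <= gauge_norm X.
Proof.
rewrite gauge_norm.unlock => aX cA; apply: lb_le_inf; first by case: (gauge_has_inf aX).
by move=> A [A0 gA]; exact: cA.
Qed.

Lemma gauge_norm_triangle X Y Z : admissible X -> admissible Y ->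
  lebesgue_measurable Z -> (forall x, 0 < x -> Z x <= X x + Y x) ->
  gauge_norm Z <= gauge_norm X + gauge_norm Y.
Proof.
move=> aX aY mZ ZXY; apply/ler_addgt0Pr => e e0.
have e20 : 0 < e / 2 by rewrite divr_gt0.
have gX : gauge (gauge_norm X + e / 2) X by apply: gauge_norm_gauge => //; rewrite ltrDl.
have gY : gauge (gauge_norm Y + e / 2) Y by apply: gauge_norm_gauge => //; rewrite ltrDl.
have X0 := gauge_norm_ge0 aX; have Y0 := gauge_norm_ge0 aY.
rewrite [X in _ + X]splitr addrACA.
have NX0 := ltr_wpDl X0 e20; have NY0 := ltr_wpDl Y0 e20.
apply: gauge_norm_le; first exact: addr_gt0.
exact: (gaugeD (adm_measurable aX) (adm_measurable aY) mZ (adm_nonneg aX)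
  (adm_nonneg aY) ZXY NX0 NY0 gX gY).
Qed.

Lemma gauge_norm_le_star X Y : lebesgue_measurable X -> nonneg_on_halfline X ->
  admissible Y -> (forall t, 0 < t -> (star X t <= star Y t)%E) ->
  admissible X /\ gauge_norm X <= gauge_norm Y.
Proof.
move=> mX X0 aY XY; have [mY Y0 [A A0 dY]] := aY; have fY := adm_finite aY.
have aX : admissible X.
  by split => //; exists A => //; exact: dominated_le_star dY.
split => //; apply/ler_addgt0Pr => e e0.
have Ne := ltr_wpDl (gauge_norm_ge0 aY) e0.
apply: gauge_norm_le => //.
have gY : gauge (gauge_norm Y + e) Y by apply: gauge_norm_gauge => //; rewrite ltrDl.
exact: gauge_le_star gY.
Qed.

Lemma gauge_norm_log X Y : admissible X -> admissible Y ->
  (forall r, 0 < r ->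
    (integral_of (log_excess r) X <= integral_of (log_excess r) Y)%E) ->
  gauge_norm X <= gauge_norm Y.
Proof.
move=> aX aY XY; have [mX X0 _] := aX; have [mY Y0 _] := aY.
apply/ler_addgt0Pr => e e0; have Ne := ltr_wpDl (gauge_norm_ge0 aY) e0.
have e20 : 0 < e / 2 by rewrite divr_gt0.
apply: gauge_norm_le => //.
have gY : gauge (gauge_norm Y + e / 2) Y by apply: gauge_norm_gauge => //; rewrite ltrDl.
have e2e : e / 2 < e by rewrite ltr_pdivrMr// ltr_pMr// ltr1n.
apply: gauge_log gY => //; first exact: ltr_wpDl (gauge_norm_ge0 aY) e20.
by rewrite ltrD2l.
Qed.

Lemma gauge_zero A X : 0 < A -> lebesgue_measurable X ->
  (forall x, 0 < x -> X x = 0) -> gauge A X.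
Proof.
move=> A0 mX X0.
have I0 phi : phi 0 = 0 -> integral_of phi X = 0%E.
  move=> p0; apply: integral0_eq => x /=; rewrite in_itv/= andbT => x0.
  by rewrite X0// p0.
split => [c c0|k k0].
  rewrite I0; last by rewrite excess_out// mulr_ge0// ltW.
  by rewrite mule_ge0 ?lee_fin ?(ltW A0)// integral_excess_ge0//; exact: lacunary_nonneg.
near=> n.
have hk : 0 <= probe n / k by rewrite divr_ge0// ltW// probe_gt0.
rewrite I0; last exact: band_low.
by rewrite lee_fin mulr_ge0 ?exprn_ge0// divr_ge0// ltW.
Unshelve. all: by end_near. Qed.

Lemma admissible_zero : admissible (fun=> 0).
Proof.
have m0 : lebesgue_measurable (fun _ : R => 0) by exact: measurable_cst.
split => //; exists 1 => //.
by have [] := @gauge_zero 1 (fun=> 0) ltr01 m0 (fun _ _ => erefl).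
Qed.

(** [f] is bounded, so domination with arbitrarily small constants kills every [G_d X]. *)
Lemma gauge_norm_eq0 X : admissible X ->
  gauge_norm X = 0 <-> ae_halfline (fun x => X x = 0).
Proof.
move=> aX; have [mX X0 _] := aX; split => [NX|Xae].
  (* Domination with constant [d / 2] at level [2], which bounds [f]. *)
  have I0 d : 0 < d -> integral_of (excess d) X = 0%E.
    move=> d0; apply/eqP; rewrite eq_le integral_excess_ge0// andbT.
    have A0 : 0 < d / 2 by rewrite divr_gt0.
    have [dX _] : gauge (d / 2) X by apply: gauge_norm_gauge => //; rewrite NX.
    have := dX 2; rewrite ltr0n => /(_ isT); rewrite divfK// => /le_trans; apply.
    rewrite (_ : integral_of (excess 2) f = 0%E) ?mule0//.
    by apply: integral0_eq => x _; rewrite excess_out// steps_le2//; exact: jump_pointP.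
  have L0 d : 0 < d -> level_measure X d = 0%E.
    move=> d0; have d20 : 0 < d / 2 by rewrite divr_gt0.
    have := markov_excess (d / 2) mX d20; rewrite I0// -splitr => h.
    apply/eqP; rewrite eq_le measure_ge0 andbT.
    by move: h; rewrite pmule_rle0 ?lte_fin.
  pose F n : set (lebesgueType R) := [set x : R | 0 < x /\ n.+1%:R^-1 < X x].
  have F0 n : mu (F n) = 0%E by apply: L0; rewrite invr_gt0.
  have mF n : measurable (F n) by exact: measurable_level.
  apply: (@negligibleS _ _ _ mu (\bigcup_n F n)).
    move=> x /= nx; have x0 : 0 < x by apply: contrapT => x0; apply: nx => /x0.
    have : 0 < X x by rewrite lt_neqAle X0// andbT eq_sym; apply/eqP => Xx; apply: nx.
    by move=> /ltr_add_invr[n]; rewrite add0r => nX; exists n.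
  apply: negligible_bigcup => n; exists (F n); split; [exact: mF|exact: F0|by []].
apply/eqP; rewrite eq_le gauge_norm_ge0// andbT.
have [_] : admissible X /\ gauge_norm X <= gauge_norm (fun=> 0).
  apply: gauge_norm_le_star => //; first exact: admissible_zero.
  move=> t t0; apply: le_star; have [N [mN N0 sub]] := Xae.
  exists N; split => // x /= nx; apply: sub => /= h.
  by apply: nx => x0; rewrite h.
move=> /le_trans; apply; apply/ler_addgt0Pr => e e0; rewrite add0r.
apply: gauge_norm_le => //; apply: gauge_zero => //.
exact: adm_measurable admissible_zero.
Qed.

Lemma admissibleZ a X Z : admissible X -> lebesgue_measurable Z -> 0 < a ->
  (forall x, 0 < x -> Z x = a * X x) -> admissible Z /\ gauge_norm Z <= a * gauge_norm X.
Proof.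
move=> aX mZ a0 ZX; have [mX X0 _] := aX; have N0 := gauge_norm_ge0 aX.
have gZ A : gauge A X -> gauge (a * A) Z by exact: gaugeZ.
split.
  split => //; first by move=> x x0; rewrite ZX// mulr_ge0 ?X0// ltW.
  exists (a * (gauge_norm X + 1)); first by rewrite mulr_gt0 ?ltr_wpDl.
  by have [] := gZ _ (gauge_norm_gauge aX (_ : _ < gauge_norm X + 1)); rewrite ?ltrDl.
apply/ler_addgt0Pr => e e0.
have ea0 : 0 < e / a by rewrite divr_gt0.
rewrite (_ : _ + e = a * (gauge_norm X + e / a)); last by rewrite mulrDr mulrCA divff ?mulr1 ?gt_eqF.
apply: gauge_norm_le; first by rewrite mulr_gt0// ltr_wpDl.
by apply: gZ; apply: gauge_norm_gauge => //; rewrite ltrDl.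
Qed.

End gauge_norm.

(** * Completeness *)

Section completeness.
Context {R : realType}.
Implicit Types (X Y Z : R -> R) (A B a c d e s t x y : R).
Local Notation mu := (@completed_lebesgue_measure R).
Local Notation leb := (@lebesgue_measure R).
Local Notation f := (@lacunary R).
Local Notation halfline := (`]0, +oo[%classic : set (lebesgueType R)).

Lemma lebesgue_measurableM X Y : lebesgue_measurable X -> lebesgue_measurable Y ->
  lebesgue_measurable (fun x => X x * Y x).
Proof. exact: measurable_funM. Qed.
Lemma lebesgue_measurableB X Y : lebesgue_measurable X -> lebesgue_measurable Y ->
  lebesgue_measurable (fun x => X x - Y x).
Proof. exact: measurable_funB. Qed.
Lemma lebesgue_measurableD X Y : lebesgue_measurable X -> lebesgue_measurable Y ->
  lebesgue_measurable (fun x => X x + Y x).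
Proof. exact: measurable_funD. Qed.
Lemma lebesgue_measurable_norm X : lebesgue_measurable X ->
  lebesgue_measurable (fun x => `|X x|).
Proof. by move=> mX; exact: (measurableT_comp (@normr_measurable R setT) mX). Qed.
Lemma lebesgue_measurable_indic (D : set (lebesgueType R)) : measurable D ->
  lebesgue_measurable (\1_D : R -> R).
Proof. by move=> mD; exact: (measurable_funS measurableT (@subsetT _ _) (measurable_indic mD)). Qed.

Lemma height_homo_excess d x y : x <= y -> excess d x <= excess d y.
Proof. by move=> xy; rewrite /excess ge_max !le_max lexx orbT andbT lerB. Qed.

Lemma excess_continuous d : continuous (excess d).
Proof.
move=> x; apply: (@continuous_max _ _ (fun x => x - d) (fun=> 0)); last exact: cvg_cst.
by apply: cvgB; [exact: cvg_id|exact: cvg_cst].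
Qed.

Lemma integral_excess_fatou (Z_ : nat -> R -> R) Z d (B : \bar R)
    (D : set (lebesgueType R)) : 0 <= d -> measurable D ->
  ae_halfline (fun x => D x) ->
  (forall i, lebesgue_measurable (Z_ i)) -> lebesgue_measurable Z ->
  (forall x, D x -> Z_ i x @[i --> \oo] --> Z x) ->
  (\forall i \near \oo, (integral_of (excess d) (Z_ i) <= B)%E) ->
  (integral_of (excess d) Z <= B)%E.
Proof.
move=> d0 mD Dae mZ_ mZ ZZ ZB.
have m1 := lebesgue_measurable_indic mD.
have mexc Y : lebesgue_measurable Y -> measurable_fun halfline (fun x => (excess d (Y x))%:E).
  by move=> mY; exact: (measurable_comp_halfline (measurable_excess d) mY).
have mW_ i := mexc _ (lebesgue_measurableM (mZ_ i) m1).
have mW := mexc _ (lebesgue_measurableM mZ m1).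
have e0 Y x : halfline x -> (0 <= (excess d (Y x))%:E)%E by move=> _; rewrite lee_fin excess_ge0.
apply: (@le_trans _ _ (\int[mu]_(x in halfline) (excess d (Z x * \1_D x))%:E)%E).
  apply: (ae_ge0_le_integral (@measurable_halfline R) (e0 Z) (mexc _ mZ) (e0 _) mW).
  have [N [mN N0 sub]] := Dae; exists N; split => // x /= nx; apply: sub => /= h.
  apply: nx; rewrite in_itv/= andbT => x0.
  by rewrite indicE mem_set ?mulr1//; exact: h.
have wcvg x : (excess d (Z_ i x * \1_D x))%:E @[i --> \oo] --> (excess d (Z x * \1_D x))%:E.
  apply: cvg_EFin; first by near=> i.
  apply: (@cvg_comp _ _ _ (fun i => Z_ i x * \1_D x) (excess d) _ (nbhs (Z x * \1_D x))); last exact: excess_continuous.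
  rewrite indicE; case: (boolP (x \in D)) => [/set_mem Dx|_].
    by rewrite mulr1; under eq_cvg do rewrite mulr1; exact: ZZ.
  by rewrite mulr0; under eq_cvg do rewrite mulr0; exact: cvg_cst.
have := fatou mu (@measurable_halfline R) mW_ (fun i => e0 (fun x => Z_ i x * \1_D x)).
rewrite [X in (X <= _)%E -> _](_ : _ = \int[mu]_(x in halfline) (excess d (Z x * \1_D x))%:E)%E; last first.
  by apply: eq_integral => x _; have [] := cvg_limn_einf_sup (wcvg x).
move=> /le_trans; apply.
have WB : \forall i \near \oo,
    (\int[mu]_(x in halfline) (excess d (Z_ i x * \1_D x))%:E <= B)%E.
  near=> i; apply: (@le_trans _ _ (integral_of (excess d) (Z_ i))); last by near: i.
  apply: (ge0_le_integral mu (@measurable_halfline R) (e0 _) (mW_ i) (mexc _ (mZ_ i))).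
  move=> x _; rewrite lee_fin indicE; case: (x \in D); rewrite ?mulr1 ?mulr0//.
  by rewrite excess_out// excess_ge0.
have [n _ nB] := WB.
rewrite limn_einf_lim; apply: lime_le; first exact: is_cvg_einfs.
near=> k; apply: ge_ereal_inf.
exists (\int[mu]_(x in halfline) (excess d (Z_ (maxn n k) x * \1_D x))%:E)%E; last exact/nB/leq_maxl.
by exists (maxn n k) => //=; exact: leq_maxr.
Unshelve. all: by end_near. Qed.

(** Monotone convergence for [(S_n - d)^+]: the limit has a finite integral. *)
Lemma ae_bounded_of_excess (S_ : nat -> R -> R) d (B : R) : 0 <= d ->
  (forall n, lebesgue_measurable (S_ n)) ->
  (forall n x, S_ n x <= S_ n.+1 x) ->
  (forall n, (integral_of (excess d) (S_ n) <= B%:E)%E) ->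
  exists D : set (lebesgueType R), [/\ measurable D, ae_halfline (fun x => D x) &
    forall x, D x -> exists b, forall n, S_ n x <= b].
Proof.
move=> d0 mS Smon SB.
pose g n (x : lebesgueType R) := (excess d (S_ n x))%:E.
have mg n : measurable_fun halfline (g n).
  exact: (measurable_comp_halfline (measurable_excess d) (mS n)).
have g0 n x : halfline x -> (0 <= g n x)%E by move=> _; rewrite lee_fin excess_ge0.
have ndg x : {homo g^~ x : n m / (n <= m)%N >-> (n <= m)%E}.
  apply: homo_leq => [y|y x' z|n]; [exact: lexx|exact: le_trans|].
  rewrite /g lee_fin; apply: height_homo_excess; exact: Smon.
pose G x := limn (g^~ x).
have mG : measurable_fun halfline G.
  by apply: (emeasurable_fun_cvg g) => // x _; exact: ereal_nondecreasing_is_cvgn.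
have G0 x : halfline x -> (0 <= G x)%E.
  move=> hx; apply: lime_ge; first exact: ereal_nondecreasing_is_cvgn.
  by near=> n; exact: g0.
have IG : (\int[mu]_(x in halfline) G x <= B%:E)%E.
  have cvI := @cvg_monotone_convergence _ _ _ mu _ (@measurable_halfline R) g mg g0
    (fun x _ => ndg x).
  rewrite -(cvg_lim _ cvI)//; apply: lime_le; first by apply/cvg_ex; eexists; exact: cvI.
  by near=> n; exact: SB.
have iG : mu.-integrable halfline G.
  apply/integrableP; split => //.
  rewrite [ltLHS](_ : _ = \int[mu]_(x in halfline) G x)%E.
    exact: le_lt_trans IG (ltry _).
  by apply: eq_integral => x /set_mem hx; rewrite gee0_abs// G0.
exists (halfline `&` [set x | (G x < +oo)%E]); split.
- exact: (emeasurable_fun_infty_o (@measurable_halfline R) mG).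
- have [N [mN N0 sub]] := integrable_ae (@measurable_halfline R) iG.
  exists N; split => // x /= nx; apply: sub => /= h; apply: nx => x0.
  have hx : halfline x by rewrite /= in_itv/= x0.
  by split => //=; rewrite -ge0_fin_numE ?G0// h.
- move=> x [hx /= Gx]; exists (d + fine (G x)) => n.
  have : (g n x <= G x)%E.
    apply: lime_ge; first exact: ereal_nondecreasing_is_cvgn.
    by near=> m; apply: ndg; near: m; exact: nbhs_infty_ge.
  rewrite -[G x]fineK ?ge0_fin_numE ?G0// lee_fin.
  have : S_ n x - d <= excess d (S_ n x) by rewrite /excess le_max lexx.
  lra.
Unshelve. all: by end_near. Qed.

(** The Riesz-Fischer argument: a subsequence with summable steps converges almost
everywhere, and domination of the differences passes to the limit by Fatou's lemma.
Convergence is stated in terms of domination, which is equivalent to norm convergence;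
the norm itself does not pass to limits, lacking the Fatou property. *)
Theorem gauge_complete (u : nat -> R -> R) :
  (forall n, lebesgue_measurable (u n)) ->
  (forall m n, admissible (fun x => `|u m x - u n x|)) ->
  (forall e, 0 < e -> exists n0, forall m n, (n0 <= m)%N -> (n0 <= n)%N ->
    gauge_norm (fun x => `|u m x - u n x|) < e) ->
  exists2 l, lebesgue_measurable l & forall e, 0 < e -> exists n0, forall n, (n0 <= n)%N ->
    dominated e (fun x => `|u n x - l x|).
Proof.
move=> mu_ adm cau.
have /choice[n0 n0P] : forall j : nat, exists k, forall m n, (k <= m)%N -> (k <= n)%N ->
    gauge_norm (fun x => `|u m x - u n x|) < (2 ^+ j.+1)^-1.
  by move=> j; apply: cau; rewrite invr_gt0 exprn_gt0.
(* Partial sums give thresholds above each [n0 j] that are also monotone. *)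
pose phi j := (\sum_(i < j.+1) n0 i)%N.
have phiS j : (phi j <= phi j.+1)%N by rewrite /phi [leqRHS]big_ord_recr/= leq_addr.
have phi_mono : {homo phi : i j / (i <= j)%N}.
  by apply: homo_leq => //; exact: leq_trans.
have phi_n0 j : (n0 j <= phi j)%N by rewrite /phi big_ord_recr/= leq_addl.
have eps0 j : 0 < (2 ^+ j.+1)^-1 :> R by rewrite invr_gt0 exprn_gt0.
have dom j m n : (phi j <= m)%N -> (phi j <= n)%N ->
    dominated ((2 ^+ j.+1)^-1) (fun x => `|u m x - u n x|).
  move=> jm jn; have [] // := gauge_norm_gauge (adm m n) (n0P j m n _ _).
    exact: leq_trans jm.
  exact: leq_trans jn.
pose v j x := `|u (phi j.+1) x - u (phi j) x|.
have mv j : lebesgue_measurable (v j).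
  exact/lebesgue_measurable_norm/lebesgue_measurableB.
pose S_ n x := \sum_(j < n) v j x.
have S_S n : S_ n.+1 = fun x => S_ n x + v n x.
  by apply/funext => x; rewrite /S_ big_ord_recr.
have mS n : lebesgue_measurable (S_ n).
  elim: n => [|n IH]; last by rewrite S_S; exact: lebesgue_measurableD.
  by rewrite (_ : S_ 0%N = fun=> 0); [exact: measurable_cst|apply/funext => x; rewrite /S_ big_ord0].
have dS n : dominated (2 - (2 ^+ n)^-1) (S_ n).
  elim: n => [|n IH].
    have S0 x : 0 < x -> S_ 0%N x = 0 by move=> _; rewrite /S_ big_ord0.
    have -> : 2 - (2 ^+ 0)^-1 = 1 :> R by rewrite expr0 invr1; lra.
    by have [] := gauge_zero ltr01 (mS 0%N) S0.
  have p0 : 0 < 2 - (2 ^+ n)^-1 :> R.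
    by rewrite subr_gt0 (@le_lt_trans _ _ 1) ?ltr1n// invf_le1 ?exprn_gt0// exprn_ege1// ler1n.
  have -> : 2 - (2 ^+ n.+1)^-1 = (2 - (2 ^+ n)^-1) + (2 ^+ n.+1)^-1 :> R.
    by rewrite exprS; field; rewrite expf_neq0.
  apply: (dominatedD (mS n) (mv n) (mS n.+1) _ p0 (eps0 n) IH).
    by move=> x _; rewrite S_S.
  exact: dom.
have d2S n : dominated 2 (S_ n).
  apply: (dominated_upper (mS n) _ _ (dS n)).
    by rewrite subr_gt0 (@le_lt_trans _ _ 1) ?ltr1n// invf_le1 ?exprn_gt0// exprn_ege1// ler1n.
  by rewrite gerBl invr_ge0 exprn_ge0.
have If := @integral_excess_lacunary_fin R _ ltr01.
have If0 : (0 <= integral_of (excess 1) f)%E by apply: integral_excess_ge0; exact: lacunary_nonneg.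
have SB n : (integral_of (excess 2) (S_ n) <= (2 * fine (integral_of (excess 1) f))%:E)%E.
  have := d2S n _ ltr01; rewrite mulr1 => /le_trans; apply.
  by rewrite EFinM fineK// ge0_fin_numE.
have Smon n x : S_ n x <= S_ n.+1 x by rewrite S_S lerDl; exact: normr_ge0.
have [D [mD Dae DP]] := ae_bounded_of_excess (ler0n R 2) mS Smon SB.
(* Cutting off to [D] makes the sequence converge at every point, hence the limit measurable. *)
pose w j x := u (phi j) x * \1_D x.
have mw j : lebesgue_measurable (w j).
  by apply: lebesgue_measurableM => //; exact: lebesgue_measurable_indic.
have ucvg x : D x -> cvgn (fun j => u (phi j) x).
  move=> Dx; have [b Sb] := DP _ Dx.
  have : cvgn (series (telescope (fun j => u (phi j) x))).
    apply: normed_cvg; apply: nondecreasing_is_cvgn.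
      apply: homo_leq => [y|y x' z|n]; [exact: lexx|exact: le_trans|].
      by rewrite [leRHS]seriesSr lerDl; exact: normr_ge0.
    exists b => _ [n _ <-]; apply: le_trans (Sb n).
    by rewrite /S_ /normed_series_of /series /= big_mkord.
  rewrite telescopeK => cv.
  rewrite (_ : (fun j => _) = (fun j => (u (phi j) x - u (phi 0%N) x) + u (phi 0%N) x)).
    by apply: is_cvgD => //; exact: is_cvg_cst.
  by apply/funext => j; rewrite subrK.
have wcvg x : cvgn (w ^~ x).
  rewrite /w; case: (pselect (D x)) => Dx.
    rewrite (_ : (fun j => _) = (fun j => u (phi j) x)); first exact: ucvg.
    by apply/funext => j; rewrite indicE mem_set ?mulr1.
  rewrite (_ : (fun j => _) = (fun=> 0)); first exact: is_cvg_cst.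
  by apply/funext => j; rewrite indicE memNset ?mulr0.
pose l x := limn (w ^~ x).
have ml : lebesgue_measurable l.
  exact: (@measurable_fun_cvg _ (lebesgueType R) R halfline w l mw (fun x _ => wcvg x)).
exists l => // e e0.
have [j _ /(_ j (leqnn j)) je] := geometric_unbounded (e^-1).
exists (phi j) => n jn.
have mB k : lebesgue_measurable (fun x => `|u n x - u k x|).
  exact/lebesgue_measurable_norm/lebesgue_measurableB.
have mBl : lebesgue_measurable (fun x => `|u n x - l x|).
  exact/lebesgue_measurable_norm/lebesgue_measurableB.
apply: (dominated_upper mBl (eps0 j)).
  rewrite -[leRHS]invrK lef_pV2 ?posrE ?invr_gt0 ?exprn_gt0//.
  by apply: (le_trans je); rewrite ler_eXn2l ?ltr1n.
move=> c c0.
apply: (@integral_excess_fatou (fun i x => `|u n x - u (phi i) x|) _ _ _ D) => //.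
- by rewrite mulr_ge0// ltW.
- move=> x Dx; apply: cvg_norm; apply: cvgB; first exact: cvg_cst.
  have wE : w ^~ x = (fun j => u (phi j) x).
    by apply/funext => i; rewrite /w indicE mem_set ?mulr1.
  by rewrite /l wE; exact: ucvg.
- near=> i; apply: dom => //; apply: phi_mono.
  by near: i; exact: nbhs_infty_ge.
Unshelve. all: by end_near. Qed.

End completeness.

(** * Real and complex scalars *)

(** Real and imaginary parts, with imaginary part zero for real scalars, allow both
kinds of scalars to be treated at once. *)
Definition re_part (R : realType) (k : scalar_kind) : scalar_field R k -> R :=
  match k return scalar_field R k -> R with
  | RealScalars => id
  | ComplexScalars => fun z : R[i] => complex.Re z
  end.

Definition im_part (R : realType) (k : scalar_kind) : scalar_field R k -> R :=
  match k return scalar_field R k -> R with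
  | RealScalars => fun=> 0
  | ComplexScalars => fun z : R[i] => complex.Im z
  end.

Definition of_parts (R : realType) (k : scalar_kind) (x y : R) : scalar_field R k :=
  match k return scalar_field R k with
  | RealScalars => x
  | ComplexScalars => Complex x y
  end.

Section scalars.
Context {R : realType}.
Variable k : scalar_kind.
Local Notation K := (scalar_field R k).
Implicit Types (z w : K) (h : R -> K) (x y : R).

Lemma modulusE z : modulus z = Num.sqrt (re_part z ^+ 2 + im_part z ^+ 2).
Proof.
case: k z => [z|[a b]] //=; by rewrite expr0n addr0 sqrtr_sqr.
Qed.

Lemma modulus_ge0 z : 0 <= modulus z.
Proof. by rewrite modulusE sqrtr_ge0. Qed.

Lemma modulus0 : modulus (0 : K) = 0.
Proof. by case: k => /=; [rewrite normr0|exact: ComplexField.Normc.normc0]. Qed.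

Lemma modulus_eq0 z : modulus z = 0 -> z = 0.
Proof.
by case: k z => [z|z] /=; [exact: normr0_eq0|exact: ComplexField.Normc.eq0_normc].
Qed.

Lemma modulusM z w : modulus (z * w) = modulus z * modulus w.
Proof. by case: k z w => [z w|z w] /=; [exact: normrM|exact: ComplexField.Normc.normcM]. Qed.

Lemma le_modulusD z w : modulus (z + w) <= modulus z + modulus w.
Proof.
case: k z w => [z w|z w] /=; first exact: ler_normD.
have normE (u : R[i]) : (ComplexField.Normc.normc u)%:C%C = `|u|.
  by rewrite normc_def; case: u.
by rewrite -lecR rmorphD/= !normE ler_normD.
Qed.

Lemma modulusN z : modulus (- z) = modulus z.
Proof. by case: k z => [z|[a b]] /=; [exact: normrN|rewrite !sqrrN]. Qed.

Lemma modulus_norm z : modulus `|z| = modulus z.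
Proof.
case: k z => [z|z]; first exact: normr_id.
change (ComplexField.Normc.normc `|z : R[i]| = ComplexField.Normc.normc z).
rewrite normc_def /= expr0n /= addr0 sqrtr_sqr ger0_norm ?sqrtr_ge0//.
by case: z.
Qed.

Lemma le_modulus z w : `|z| <= `|w| -> modulus z <= modulus w.
Proof.
case: k z w => [z w //|z w].
change (`|z : R[i]| <= `|w : R[i]| ->
  ComplexField.Normc.normc z <= ComplexField.Normc.normc w).
by rewrite !normc_def lecR; case: z; case: w.
Qed.

Lemma modulus_real_part z : modulus (real_part z) <= modulus z.
Proof.
case: k z => [z //|[a b]] /=.
by rewrite expr0n/= addr0 ler_sqrt ?addr_ge0 ?sqr_ge0// lerDl sqr_ge0.
Qed.

Lemma re_part_le z : `|re_part z| <= modulus z.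
Proof. by rewrite modulusE -sqrtr_sqr ler_sqrt ?addr_ge0 ?sqr_ge0// lerDl sqr_ge0. Qed.
Lemma im_part_le z : `|im_part z| <= modulus z.
Proof. by rewrite modulusE -sqrtr_sqr ler_sqrt ?addr_ge0 ?sqr_ge0// lerDr sqr_ge0. Qed.

Lemma modulus_le_parts z : modulus z <= `|re_part z| + `|im_part z|.
Proof.
rewrite modulusE -[leRHS]ger0_norm ?addr_ge0// -sqrtr_sqr ler_sqrt ?sqr_ge0//.
rewrite sqrrD !real_normK ?num_real// lerD2r lerDl mulrn_wge0// mulr_ge0//.
Qed.

Lemma re_partB z w : re_part (z - w) = re_part z - re_part w.
Proof. by case: k z w => [z w|[a b] [c d]]. Qed.
Lemma im_partB z w : im_part (z - w) = im_part z - im_part w.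
Proof. by case: k z w => [z w|[a b] [c d]] //=; rewrite subr0. Qed.
Lemma re_part_of_parts x y : re_part (of_parts k x y) = x. Proof. by case: k. Qed.
Lemma modulus_of_parts x : modulus (of_parts k x 0) = `|x|.
Proof. by case: k => //=; rewrite expr0n/= addr0 sqrtr_sqr. Qed.
Lemma im_part_sub_le z x y : `|im_part (z - of_parts k x y)| <= `|im_part z - y|.
Proof. by case: k z => [z|[a b]] //=; rewrite normr0. Qed.

Lemma L0P h : L0 h <-> lebesgue_measurable (fun x => re_part (h x)) /\
                       lebesgue_measurable (fun x => im_part (h x)).
Proof.
case: k h => [h|h] //=; split => [mh|[]//]; split => //; exact: measurable_cst.
Qed.

Lemma L0_of_parts X Y : lebesgue_measurable X -> lebesgue_measurable Y ->
  L0 (fun x => of_parts k (X x) (Y x)).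
Proof. by case: k. Qed.

Lemma L0D h1 h2 : L0 h1 -> L0 h2 -> L0 (fun x => h1 x + h2 x).
Proof.
case: k h1 h2 => [h1 h2|h1 h2] /=; first exact: lebesgue_measurableD.
move=> [r1 i1] [r2 i2]; split.
  rewrite (_ : (fun x => _) = (fun x => complex.Re (h1 x) + complex.Re (h2 x))).
    exact: lebesgue_measurableD.
  by apply/funext => x; case: (h1 x); case: (h2 x).
rewrite (_ : (fun x => _) = (fun x => complex.Im (h1 x) + complex.Im (h2 x))).
  exact: lebesgue_measurableD.
by apply/funext => x; case: (h1 x); case: (h2 x).
Qed.

Lemma L0Z z h : L0 h -> L0 (fun x => z * h x).
Proof.
have mcst (c : R) : lebesgue_measurable (fun=> c) by exact: measurable_cst.
case: k z h => [z h|[a b] h] /=; first by move=> mh; exact: lebesgue_measurableM.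
move=> [rh ih]; split.
  rewrite (_ : (fun x => _) = (fun x => a * complex.Re (h x) - b * complex.Im (h x))).
    by apply: lebesgue_measurableB; exact: lebesgue_measurableM.
  by apply/funext => x; case: (h x).
rewrite (_ : (fun x => _) = (fun x => a * complex.Im (h x) + b * complex.Re (h x))).
  by apply: lebesgue_measurableD; exact: lebesgue_measurableM.
by apply/funext => x; case: (h x).
Qed.

Lemma L0B h1 h2 : L0 h1 -> L0 h2 -> L0 (fun x => h1 x - h2 x).
Proof.
move=> m1 m2; rewrite (_ : (fun x => _) = (fun x => h1 x + (-1) * h2 x)).
  exact/L0D/L0Z.
by apply/funext => x; rewrite mulN1r.
Qed.

Lemma L0_cst z : L0 (fun=> z : K).
Proof. by apply/L0P; split; exact: measurable_cst. Qed.

Lemma modulus_measurable h : L0 h -> lebesgue_measurable (fun x => modulus (h x)).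
Proof.
move=> /L0P[mr mi].
rewrite (_ : (fun x => _) =
  (fun x => Num.sqrt (re_part (h x) ^+ 2 + im_part (h x) ^+ 2))); last first.
  by apply/funext => x; exact: modulusE.
have msq : measurable_fun [set: R] (@Num.sqrt R).
  by apply: continuous_measurable_fun; exact: sqrt_continuous.
apply: (measurableT_comp msq); apply: measurable_funD; exact: measurable_funX.
Qed.

Lemma L0_real_part h : L0 h -> L0 (fun x => real_part (h x)).
Proof.
case: k h => [//|h] /= [mr _]; split => //; exact: measurable_cst.
Qed.

Lemma L0_norm h : L0 h -> L0 (fun x => `|h x|).
Proof.
move=> mh; have mm := modulus_measurable mh.
rewrite (_ : (fun x => _) = (fun x => of_parts k (modulus (h x)) 0)).
  by apply: L0_of_parts => //; exact: measurable_cst.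
apply/funext => x; case: k h {mh mm} => [//|h].
change (`|h x : R[i]| = (ComplexField.Normc.normc (h x))%:C%C).
by rewrite normc_def; case: (h x).
Qed.

Lemma of_parts_ge0 x : 0 <= x -> 0 <= of_parts k x 0.
Proof. by case: k => //= x0; rewrite lecR. Qed.
Lemma le_of_parts x y : x <= y -> of_parts k x 0 <= of_parts k y 0.
Proof. by case: k => //= xy; rewrite lecR. Qed.
End scalars.

(** * The space and its properties *)

Section the_space.
Context {R : realType}.
Variable k : scalar_kind.
Local Notation K := (scalar_field R k).
Local Notation leb := (@lebesgue_measure R).
Implicit Types (h u v : R -> K) (X Y Z : R -> R).
Local Notation psi := (@psi R).
Local Notation f := (@lacunary R).
Local Notation g := (@spread R).
Local Notation M_psi := (@Marcinkiewicz_space R k psi).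
Local Notation mod h := (fun x => modulus (h x)).

Definition space_norm h := gauge_norm (mod h).

Lemma admissibleD X Y Z : admissible X -> admissible Y -> lebesgue_measurable Z ->
  nonneg_on_halfline Z -> (forall x, 0 < x -> Z x <= X x + Y x) -> admissible Z.
Proof.
move=> [mX X0 [A A0 dX]] [mY Y0 [B B0 dY]] mZ Z0 ZXY; split => //.
by exists (A + B); [exact: addr_gt0|exact: dominatedD dX dY].
Qed.

Lemma admissible_le X Y : lebesgue_measurable X -> nonneg_on_halfline X ->
  admissible Y -> ae_halfline (fun x => X x <= Y x) ->
  admissible X /\ gauge_norm X <= gauge_norm Y.
Proof. by move=> mX X0 aY XY; apply: gauge_norm_le_star => // t t0; exact: le_star. Qed.

Lemma ae_of_all (P : R -> Prop) : (forall x, 0 < x -> P x) -> ae_halfline P.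
Proof. by move=> h; apply: aeW => x; exact: h. Qed.

Lemma mod_nonneg h : nonneg_on_halfline (mod h).
Proof. by move=> x _; exact: modulus_ge0. Qed.

Lemma Marcinkiewicz_norm_leP (A : R) h : L0 h -> 0 < A ->
  (Marcinkiewicz_norm psi h <= A%:E)%E <-> dominated A (mod h).
Proof.
move=> mh A0; have mm := modulus_measurable mh.
rewrite (dominatedP mm (mod_nonneg h) A0); split.
  move=> hA t t0; have p0 := psi_gt0 t0.
  have := le_trans (ereal_sup_ubound _) hA => /(_ ((psi t)^-1%:E *
    \int[leb]_(s in `]0%R, t[) rearrangement h s)%E).
  have -> : (A * psi t)%:E = ((psi t)%:E * A%:E)%E by rewrite -EFinM mulrC.
  by rewrite -lee_pdivrMl//; apply; exists t.
move=> hA; apply: ge_ereal_sup => _ [t t0 <-]; have p0 := psi_gt0 t0.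
by rewrite lee_pdivrMl// -EFinM mulrC; exact: hA.
Qed.

Lemma Marcinkiewicz_norm_ge0 h : (0 <= Marcinkiewicz_norm psi h)%E.
Proof.
apply: le_trans (ereal_sup_ubound _); last by exists 1 => //=; exact: ltr01.
rewrite mule_ge0//; first by rewrite lee_fin invr_ge0 ltW// psi_gt0.
by apply: integral_ge0 => s _; exact: star_ge0.
Qed.

Lemma M_psiP h : M_psi h <-> L0 h /\ admissible (mod h).
Proof.
split => -[mh]; last first.
  move=> [_ _ [A A0 dA]]; split => //; apply: le_lt_trans (ltry A).
  exact/Marcinkiewicz_norm_leP.
move=> hfin; split => //; split; [exact: modulus_measurable|exact: mod_nonneg|].
have n0 := Marcinkiewicz_norm_ge0 h.
have A0 : 0 < fine (Marcinkiewicz_norm psi h) + 1 by rewrite ltr_wpDl ?fine_ge0.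
exists (fine (Marcinkiewicz_norm psi h) + 1) => //.
apply/Marcinkiewicz_norm_leP => //.
by rewrite EFinD fineK ?ge0_fin_numE// leeDl// lee_fin.
Qed.

Lemma M_psi_ideal u v : M_psi v -> L0 u ->
  (forall t, 0 < t -> (rearrangement u t <= rearrangement v t)%E) ->
  M_psi u /\ space_norm u <= space_norm v.
Proof.
move=> /M_psiP[mv av] mu uv.
have [au uvN] := gauge_norm_le_star (modulus_measurable mu) (mod_nonneg u) av uv.
by split => //; apply/M_psiP.
Qed.

Lemma M_psi_le u v : M_psi v -> L0 u -> ae_halfline (fun x => modulus (u x) <= modulus (v x)) ->
  M_psi u /\ space_norm u <= space_norm v.
Proof. by move=> Ev mu uv; apply: M_psi_ideal => // t t0; exact: le_star. Qed.

Lemma M_psi_sublattice : vector_sublattice M_psi.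
Proof.
split.
- by move=> h [].
- move=> u v Eu mv [N [mN N0 sub]]; have [] // := @M_psi_le v u Eu mv.
  exists N; split => // x /= nx; apply: sub => /= e; apply: nx => x0.
  by rewrite e.
- apply/M_psiP; split; first exact: L0_cst.
  rewrite (_ : mod _ = fun=> 0); first exact: admissible_zero.
  by apply/funext => x; exact: modulus0.
- move=> u v /M_psiP[mu au] /M_psiP[mv av]; have muv := L0D mu mv.
  apply/M_psiP; split => //; apply: (admissibleD au av (modulus_measurable muv)).
    exact: mod_nonneg.
  by move=> x _; exact: le_modulusD.
- move=> c u /M_psiP[mu au]; have mcu := L0Z c mu.
  have [c0|c0] := eqVneq (modulus c) 0.
    have z0 x : modulus (c * u x) = 0 by rewrite modulusM c0 mul0r.
    have z : (fun x => modulus (c * u x)) = (fun=> 0) by apply/funext => x; exact: z0.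
    by apply/M_psiP; split => //=; rewrite z; exact: admissible_zero.
  have c0' : 0 < modulus c by rewrite lt_neqAle eq_sym c0 modulus_ge0.
  apply/M_psiP; split => //.
  have [] // := admissibleZ au (modulus_measurable mcu) c0'.
  by move=> x _; exact: modulusM.
- move=> u Eu; have [mu _] := Eu.
  have [] // := @M_psi_le _ u Eu (L0_real_part mu).
  by apply: ae_of_all => x _; exact: modulus_real_part.
- move=> u Eu; have [mu _] := Eu.
  have [] // := @M_psi_le _ u Eu (L0_norm mu).
  by apply: ae_of_all => x _; rewrite modulus_norm.
Qed.

Lemma space_norm_lattice : lattice_norm M_psi space_norm.
Proof.
split.
- by move=> u /M_psiP[_ au]; exact: gauge_norm_ge0.
- move=> u /M_psiP[_ au]; rewrite (gauge_norm_eq0 au).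
  have E (P Q : R -> Prop) : (forall x, P x -> Q x) -> ae_halfline P -> ae_halfline Q.
    move=> PQ [N [mN N0 sub]]; exists N; split => // x /= nx; apply: sub => /= e.
    by apply: nx => x0; apply: PQ; exact: e.
  split; apply: E => x; first exact: modulus_eq0.
  by move=> ->; exact: modulus0.
- move=> c u /M_psiP[mu au]; have mcu := modulus_measurable (L0Z c mu).
  have [c0|c0] := eqVneq (modulus c) 0.
    have z0 x : modulus (c * u x) = 0 by rewrite modulusM c0 mul0r.
    have z : mod (fun x => c * u x) = fun=> 0 by apply/funext => x; exact: z0.
    rewrite /space_norm z c0 mul0r; apply/(gauge_norm_eq0 admissible_zero).
    by apply: ae_of_all.
  have c0' : 0 < modulus c by rewrite lt_neqAle eq_sym c0 modulus_ge0.
  have [acu cu] := admissibleZ au mcu c0' (fun x _ => modulusM c (u x)).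
  have cV : 0 < (modulus c)^-1 by rewrite invr_gt0.
  have uE x : 0 < x -> modulus (u x) = (modulus c)^-1 * modulus (c * u x).
    by move=> _; rewrite modulusM mulKf.
  have [_ uc] := admissibleZ acu (modulus_measurable mu) cV uE.
  apply/eqP; rewrite eq_le cu /= -ler_pdivlMl//.
- move=> u v /M_psiP[mu au] /M_psiP[mv av].
  apply: gauge_norm_triangle => //; first exact/modulus_measurable/L0D.
  by move=> x _; exact: le_modulusD.
- move=> u v Eu Ev uv; have [mu _] := Eu.
  have [] // := @M_psi_le u v Ev mu.
  have [N [mN N0 sub]] := uv; exists N; split => // x /= nx; apply: sub => /= e.
  by apply: nx => x0; apply: le_modulus; exact: e.
Qed.

(** Completeness is inherited from the real and imaginary parts, whose moduli are bounded
by the modulus. *)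
Lemma space_norm_complete : norm_complete M_psi space_norm.
Proof.
move=> u Eu cau.
have mu n : L0 (u n) by have [] := Eu n.
have au n : admissible (mod (u n)) by have /M_psiP[] := Eu n.
have aB m n : admissible (fun x => modulus (u m x - u n x)).
  apply: (admissibleD (au m) (au n)).
  - exact/modulus_measurable/L0B.
  - exact: mod_nonneg.
  - by move=> x _; rewrite (le_trans (le_modulusD _ _))// modulusN.
have part (P : nat -> R -> R) : (forall n, lebesgue_measurable (P n)) ->
    (forall m n x, `|P m x - P n x| <= modulus (u m x - u n x)) ->
    exists2 l, lebesgue_measurable l & forall e, 0 < e -> exists n0, forall n,
      (n0 <= n)%N -> dominated e (fun x => `|P n x - l x|).
  move=> mP Pu.
  have aP m n : admissible (fun x => `|P m x - P n x|) /\
      gauge_norm (fun x => `|P m x - P n x|) <= space_norm (fun x => u m x - u n x).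
    apply: admissible_le => //; first exact/lebesgue_measurable_norm/lebesgue_measurableB.
    by apply: ae_of_all => x _; exact: Pu.
  apply: gauge_complete => // [m n|e e0]; first by have [] := aP m n.
  have [n0 n0P] := cau _ e0; exists n0 => m n mn nn.
  by have [_ /le_lt_trans] := aP m n; apply; exact: n0P.
have [l1 ml1 l1P] : exists2 l, lebesgue_measurable l & forall e, 0 < e -> exists n0, forall n,
    (n0 <= n)%N -> dominated e (fun x => `|re_part (u n x) - l x|).
  apply: (part (fun n x => re_part (u n x))) => [n|m n x]; first by have /L0P[] := mu n.
  by rewrite -re_partB; exact: re_part_le.
have [l2 ml2 l2P] : exists2 l, lebesgue_measurable l & forall e, 0 < e -> exists n0, forall n,
    (n0 <= n)%N -> dominated e (fun x => `|im_part (u n x) - l x|).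
  apply: (part (fun n x => im_part (u n x))) => [n|m n x]; first by have /L0P[] := mu n.
  by rewrite -im_partB; exact: im_part_le.
pose l x : K := of_parts k (l1 x) (l2 x).
have ml : L0 l by exact: L0_of_parts.
have mul n : L0 (fun x => u n x - l x) by exact: L0B.
have dul e : 0 < e -> exists n0, forall n, (n0 <= n)%N ->
    dominated (e + e) (fun x => modulus (u n x - l x)).
  move=> e0; have [n1 n1P] := l1P _ e0; have [n2 n2P] := l2P _ e0.
  exists (maxn n1 n2) => n; rewrite geq_max => /andP[/n1P d1 /n2P d2].
  have /L0P[mr mi] := mu n.
  apply: (dominatedD _ _ _ _ e0 e0 d1 d2).
  - exact/lebesgue_measurable_norm/lebesgue_measurableB.
  - exact/lebesgue_measurable_norm/lebesgue_measurableB.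
  - exact: modulus_measurable.
  - move=> x _; apply: (le_trans (modulus_le_parts _)); apply: lerD.
      by rewrite re_partB re_part_of_parts.
    exact: im_part_sub_le.
have aul n0 : dominated (1 + 1) (fun x => modulus (u n0 x - l x)) ->
    admissible (fun x => modulus (u n0 x - l x)).
  by move=> d; split; [exact: modulus_measurable|exact: mod_nonneg|exists (1 + 1)].
exists l.
  have [n0 /(_ n0 (leqnn n0)) /aul a] := dul _ ltr01.
  apply/M_psiP; split => //.
  apply: (admissibleD (au n0) a); [exact: modulus_measurable|exact: mod_nonneg|].
  move=> x _; rewrite -[l x](subKr (u n0 x)).
  by rewrite (le_trans (le_modulusD _ _))// modulusN opprB subrKC.
apply/cvgrPdist_le => e e0.
have e24 : 0 < e / 24 by rewrite divr_gt0.
have [n0 n0P] := dul _ e24; exists n0 => // n /= nn.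
have d := n0P n nn; have mm := modulus_measurable (mul n).
have a : admissible (fun x => modulus (u n x - l x)).
  by split => //; [exact: mod_nonneg|exists (e / 24 + e / 24) => //; exact: addr_gt0].
rewrite sub0r normrN ger0_norm ?gauge_norm_ge0//.
apply: gauge_norm_le => //.
have eE : 12 * (e / 24 + e / 24) = e by field.
by rewrite -[X in gauge X]eE; exact: gauge_of_dominated (addr_gt0 e24 e24) mm d.
Qed.

Lemma space_norm_log u v : M_psi u -> M_psi v -> log_submajorized u v -> space_norm u <= space_norm v.
Proof.
move=> /M_psiP[mu au] /M_psiP[mv av] [iu iv uv].
apply: gauge_norm_log => // r r0.
apply: log_excess_le_of_log_submajorized => //;
  by [exact: adm_measurable|exact: adm_nonneg|exact: adm_finite].
Qed.

(** The bounds are [1] and [12], the latter from [flat_of_dominated]. *)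
Lemma space_norm_equivalent : equivalent_to_Marcinkiewicz_norm M_psi space_norm psi.
Proof.
exists 1, 12; split => // u Eu; have /M_psiP[mu au] := Eu.
have [_ ufin] := Eu; have n0 := Marcinkiewicz_norm_ge0 u.
rewrite mul1e; apply/andP; split.
  rewrite -[leLHS]fineK ?ge0_fin_numE// lee_fin; apply: gauge_norm_ge => // A A0 [dA _].
  by rewrite -lee_fin fineK ?ge0_fin_numE//; exact/Marcinkiewicz_norm_leP.
rewrite -[X in (_ * X)%E]fineK ?ge0_fin_numE// -EFinM lee_fin.
set a := fine _; have a0 : 0 <= a by rewrite fine_ge0.
apply/ler_addgt0Pr => e e0; have e12 : 0 < e / 12 by rewrite divr_gt0.
have ae0 : 0 < a + e / 12 by rewrite ltr_wpDl.
have -> : 12 * a + e = 12 * (a + e / 12) by field.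
apply: gauge_norm_le; first by rewrite mulr_gt0.
apply: gauge_of_dominated => //; first exact: modulus_measurable.
apply/Marcinkiewicz_norm_leP => //.
by rewrite EFinD fineK ?ge0_fin_numE// leeDl// lee_fin ltW.
Qed.

Definition lift_fun X : R -> K := fun x => of_parts k (X x) 0.

Lemma lift_fun_L0 X : lebesgue_measurable X -> L0 (lift_fun X).
Proof. by move=> mX; apply: L0_of_parts => //; exact: measurable_cst. Qed.

Lemma mod_lift_fun X : (forall x, 0 <= X x) -> mod (lift_fun X) = X.
Proof. by move=> X0; apply/funext => x; rewrite modulus_of_parts ger0_norm. Qed.

Lemma lacunary_ge0 x : 0 <= f x. Proof. exact: (steps_ge0 jump_pointP). Qed.
Lemma spread_ge0 x : 0 <= g x. Proof. exact: (steps_ge0 spread_pointP). Qed.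

Lemma admissible_spread : admissible g.
Proof.
by split; [exact: spread_measurable|exact: spread_nonneg|exists 1 => //; exact: dominated_spread].
Qed.
Lemma admissible_lacunary : admissible f.
Proof.
by split; [exact: lacunary_measurable|exact: lacunary_nonneg|exists 1 => //; have [] := @gauge_lacunary R].
Qed.

Lemma M_psi_lift X : admissible X -> (forall x, 0 <= X x) -> M_psi (lift_fun X).
Proof.
move=> aX X0; apply/M_psiP; split; first exact/lift_fun_L0/adm_measurable.
by rewrite mod_lift_fun.
Qed.

Lemma space_norm_lift X : (forall x, 0 <= X x) -> space_norm (lift_fun X) = gauge_norm X.
Proof. by move=> X0; rewrite /space_norm mod_lift_fun. Qed.

Lemma space_norm_lacunary_le1 : space_norm (lift_fun f) <= 1.
Proof. by rewrite space_norm_lift; [exact: gauge_norm_le gauge_lacunary|exact: lacunary_ge0]. Qed.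

Lemma space_norm_spread_ge2 : 2 <= space_norm (lift_fun g).
Proof.
rewrite space_norm_lift; last exact: spread_ge0.
by apply: gauge_norm_ge admissible_spread _ => A _; exact: gauge_spread_ge2.
Qed.

Lemma nonneg_decreasing_lift X : (forall x, 0 <= X x) -> {homo X : x y /~ y <= x} ->
  nonneg_decreasing (lift_fun X).
Proof.
move=> X0 Xdec; split => [x _|x y _ xy]; first exact: of_parts_ge0.
by apply: le_of_parts; exact: Xdec.
Qed.

Lemma submajorized_spread_lacunary : submajorized (lift_fun g) (lift_fun f).
Proof.
move=> t t0; rewrite !rearrangementE mod_lift_fun; last exact: spread_ge0.
rewrite mod_lift_fun; last exact: lacunary_ge0.
by rewrite [leRHS]integral_star_lacunary//; exact: integral_star_spread_le.
Qed.

Definition spread_truncation (n : nat) (x : R) : R := g x * (x <= n%:R)%R%:R.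

(** The truncations of [g] have norm at most [1] and increase to [g], whose norm is at
least [2]. *)
Lemma not_Fatou : ~ Fatou_property M_psi space_norm.
Proof.
have tr_ge0 n x : 0 <= spread_truncation n x by rewrite mulr_ge0 ?spread_ge0.
have tr_le n x : spread_truncation n x <= g x.
  by rewrite /spread_truncation ler_piMr ?spread_ge0//; case: (x <= _).
have mtr n : lebesgue_measurable (spread_truncation n).
  apply: nonincreasing_lebesgue_measurable => y x yx.
  apply: ler_pM => //; [exact: spread_ge0|exact: (steps_nonincreasing spread_pointP)|].
  by rewrite ler_nat; case: (leP x) => // xn; rewrite (le_trans yx xn).
have g1 n : gauge 1 (spread_truncation n.+1).
  apply: (@gauge_bounded_support _ _ n.+1%:R) => //.
  by move=> x; rewrite /spread_truncation ltNge => /negbTE ->; rewrite mulr0.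
have atr n : admissible (spread_truncation n.+1).
  by split => //; exists 1 => //; have [] := g1 n.
move=> /(_ (fun n => lift_fun (spread_truncation n.+1)) (lift_fun g)).
have E1 n : M_psi (lift_fun (spread_truncation n.+1)) by apply: M_psi_lift.
have N1 n : space_norm (lift_fun (spread_truncation n.+1)) <= 1.
  by rewrite space_norm_lift//; exact: gauge_norm_le (g1 n).
move=> /(_ E1 (lift_fun_L0 spread_measurable)) [| |_ _ cvN].
- apply: ae_of_all => x x0; split.
  + by move=> m; exact: of_parts_ge0.
  + move=> m; apply: le_of_parts; rewrite /spread_truncation ler_wpM2l ?spread_ge0// ler_nat.
    by case: (leP x) => // xm; rewrite (le_trans xm)// ler_nat.
  + apply: cvg_near_cst; near=> m.
    rewrite /lift_fun /spread_truncation.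
    have -> : x <= m.+1%:R.
      by rewrite (@le_trans _ _ m%:R) ?ler_nat//; near: m; exact: nbhs_infty_ger.
    by rewrite mulr1 subrr modulus0.
- by exists 1.
have : space_norm (lift_fun g) <= 1.
  rewrite -(cvg_lim _ cvN)//; apply: limr_le; first by apply/cvg_ex; eexists; exact: cvN.
  exact: nearW.
by move=> /(le_trans space_norm_spread_ge2); rewrite leNgt ltr1n.
Unshelve. all: by end_near. Qed.

End the_space.

Theorem theorem1p1 (R : realType) (k : scalar_kind) :
  exists (E : set (R -> scalar_field R k)) (N : (R -> scalar_field R k) -> R),
    symmetric_Banach_lattice E N /\
    (forall u v, E u -> E v -> log_submajorized u v -> N u <= N v) /\
    ~ strongly_symmetric E N /\
    (exists f g, E f /\ E g /\ nonneg_decreasing f /\ nonneg_decreasing g /\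
       submajorized g f /\ N f < N g) /\
    (exists psi : R -> R, Marcinkiewicz_weight psi /\
       E = @Marcinkiewicz_space R k psi /\
       equivalent_to_Marcinkiewicz_norm E N psi) /\
    ~ Fatou_property E N.
Proof.
have Ef : Marcinkiewicz_space psi (lift_fun k (@lacunary R)).
  by apply: M_psi_lift; [exact: admissible_lacunary|exact: lacunary_ge0].
have Eg : Marcinkiewicz_space psi (lift_fun k (@spread R)).
  by apply: M_psi_lift; [exact: admissible_spread|exact: spread_ge0].
have fg : space_norm (lift_fun k (@lacunary R)) < space_norm (lift_fun k (@spread R)).
  by apply: (le_lt_trans (space_norm_lacunary_le1 k)); apply: lt_le_trans (space_norm_spread_ge2 k); rewrite ltr1n.
exists (@Marcinkiewicz_space R k psi), (@space_norm R k).
split; [|split; [|split; [|split; [|split]]]].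
- split; last exact: M_psi_ideal.
  by split; [exact: M_psi_sublattice|exact: space_norm_lattice|exact: space_norm_complete].
- exact: space_norm_log.
- move=> /(_ _ _ Eg Ef (submajorized_spread_lacunary k)); by rewrite leNgt fg.
- exists (lift_fun k (@lacunary R)), (lift_fun k (@spread R)).
  split; first exact: Ef.
  split; first exact: Eg.
  split.
    by apply: nonneg_decreasing_lift; [exact: lacunary_ge0|exact: (steps_nonincreasing jump_pointP)].
  split.
    by apply: nonneg_decreasing_lift; [exact: spread_ge0|exact: (steps_nonincreasing spread_pointP)].
  split; first exact: submajorized_spread_lacunary.
  exact: fg.
- exists psi; split; first exact: psi_weight.
  by split => //; exact: space_norm_equivalent.
- exact: not_Fatou.
Qed.
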